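(* Let $x=x(T)$ be a real-valued function with $x^2\le T^{1/4}$. Let $y=y(T)$ be a positive function with $T^2y^{-1}\to\infty$ as $T\to\infty$. Then $$P_{x,T}(y)=\mathbb{P}_x\left(I_T\le y\right)\sim\frac{4}{\sqrt{\pi T^2y^{-1}}}\,\exp\left(-\frac{(T+x^2)^2}{8y}\right),\qquad T\to\infty.$$
   Context: Under $\mathbb{P}_x$, the process $W=(W_t)_{t\ge 0}$ is a one-dimensional Brownian motion starting at $x\in\mathbb{R}$; $I_T:=\int_0^T W_s^2\,\mathrm{d}s$ for $T\ge 0$, and $P_{x,T}(y):=\mathbb{P}_x(I_T\le y)$. In the claim, $x$ and $y$ stand for $x(T)$ and $y(T)$. The notation $F(T)\sim G(T)$ as $T\to\infty$ means $F(T)/G(T)\to 1$. *)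

(* Defs.v *)
From HB Require Import structures.
From mathcomp Require Export all_boot all_order all_algebra.
From mathcomp Require Export all_classical all_reals all_analysis.
Export Order.TTheory GRing.Theory Num.Theory.
Export numFieldNormedType.Exports.

Set Implicit Arguments.
Unset Strict Implicit.
Unset Printing Implicit Defensive.

Local Open Scope classical_set_scope.
Local Open Scope ring_scope.

(** Since the [B i] are arbitrary Borel sets (possibly [setT]), the product rule
    for the whole family contains the product rule for every subfamily. *)
Definition independent_RVs (R : realType) (d : measure_display)
    (Omega : measurableType d) (P : probability Omega R) (n : nat)
    (X : 'I_n -> Omega -> R) : Prop :=
  forall B : 'I_n -> set R, (forall i, measurable (B i)) ->
    P [set w | forall i, B i (X i w)] = (\prod_(i < n) P (X i @^-1` B i))%E.

(** The time index is a real number, but only the times [0 <= t] are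
    constrained.  Every path is continuous on [[0, +oo[], so that events
    depending on the whole path, such as [I_T <= y], are measurable.  The second
    parameter of [normal_prob] is the standard deviation, and [normal_prob m 0]
    is not the Dirac mass at [m], whence the strict inequality [s < t]. *)
Record brownian_motion (R : realType) (d : measure_display)
    (Omega : measurableType d) (P : probability Omega R)
    (W : R -> Omega -> R) (x : R) : Prop := BrownianMotion {
  bm_measurable : forall t : R, 0 <= t -> measurable_fun setT (W t) ;
  bm_start : {ae P, forall w, W 0 w = x} ;
  bm_continuous : forall w,
    {within `[0, +oo[, continuous (fun t : R => W t w)} ;
  bm_gaussian : forall s t : R, 0 <= s -> s < t ->
    forall B : set R, measurable B ->
      pushforward P (W t \- W s) B = normal_prob 0 (Num.sqrt (t - s)) B ;
  bm_independent : forall (n : nat) (t : nat -> R), 0 <= t 0%N ->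
    (forall i, (i < n)%N -> t i <= t i.+1) ->
    independent_RVs P (fun i : 'I_n => W (t i.+1) \- W (t i))
}.

Definition sq_integral (R : realType) (d : measure_display)
    (Omega : measurableType d) (W : R -> Omega -> R) (T : R)
    (w : Omega) : R :=
  \int[lebesgue_measure]_(s in `[0, T]) (W s w ^+ 2).

Definition sq_integral_cdf (R : realType) (d : measure_display)
    (Omega : measurableType d) (P : R -> probability Omega R)
    (W : R -> Omega -> R) (x T y : R) : R :=
  fine (P x [set w | sq_integral W T w <= y]).

Definition asymp_equiv (R : realType) (F G : R -> R) : Prop :=
  F T / G T @[T --> +oo] --> (1 : R).

(* Main.v *)
From HB Require Import structures.
Require Import Defs.
From mathcomp Require Import measurable_realfun.
From mathcomp Require Import ring lra.
Import HBNNSimple.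

Set Implicit Arguments.
Unset Strict Implicit.
Unset Printing Implicit Defensive.

Local Open Scope classical_set_scope.
Local Open Scope ring_scope.

(** The Laplace transform of the law of [I_T], written in the variable [l]
    with [s = l^2/2], is the Cameron-Martin formula
    [E_x exp (- s I_T) = cosh (l T)^(-1/2) exp (- (x^2 l / 2) tanh (l T))]
    ([laplace_sq_integral]).  For large [l T] it is close to
    [sqrt 2 * exp (- l a)] with [a = (T + x^2)/2].  The function [exp (- l a)]
    is the Laplace transform of the law of [a^2 / N^2], [N] a standard normal
    variable, that is, of the hitting time of [a] by a Brownian motion started
    at [0]; the mass it gives to [t <= y] is the Gaussian tail
    [2 P(N >= a / sqrt y)].  Hence [P_x(I_T <= y)] should be close to
    [2 sqrt 2 P(N >= a / sqrt y)], and the Mills ratio turns this into the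
    claimed expression, up to the factor [T / (T + x^2)], which tends to [1]
    because [x^2 <= T^(1/4)].

    The approximation is made rigorous without inverting any transform.  With
    [q = exp (- 2 l T)] there is an exact factorization
    [L(l) exp (loss l) = sqrt 2 exp (- l a) exp (gain l)]
    ([cameron_martin_factor]), where [L] is the Cameron-Martin transform and
    [loss] and [gain] are of order [q], up to a factor affine in [l].  Both are
    themselves Laplace transforms of positive measures, so that
    [L + L (exp loss - 1) = sqrt 2 exp (- l a)
      + sqrt 2 exp (- l a) (exp gain - 1)]
    is an identity between sums of Laplace transforms of positive measures.  By
    uniqueness of the Laplace transform ([laplace_rep_unique_add]) it holds for
    the masses of [t <= y] as well.  The masses of the two correction measures
    are bounded by the exponential Markov inequality at the saddle point
    [l = a / y], which produces the main exponential factor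
    [exp (- a^2 / (2 y))] times [loss + gain] at [a / y]
    ([cdf_hitting_comparison]).  There [q <= exp (- r)] with [r = T^2 / y], and
    [r exp (- r)] is negligible with respect to the prefactor [r^(-1/2)] of the
    main term.

    The Cameron-Martin formula comes from a discretization: the sum of the
    squares of a Gaussian random walk has an explicit Laplace transform, governed
    by a Riccati recursion that becomes linear in projective coordinates
    ([walk_laplace]), and the Riemann sums of the continuous paths converge. *)

(** * Densities and image measures *)

(** Both sides agree on indicators, hence on simple functions, and the general
    case follows by monotone convergence. *)
Lemma integral_density (R : realType) (d : measure_display)
    (T : measurableType d) (mu nu : {measure set T -> \bar R}) (g : T -> R) :
  measurable_fun setT g -> (forall t, 0 <= g t) ->
  (forall A, measurable A -> nu A = (\int[mu]_(t in A) (g t)%:E)%E) ->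
  forall f : T -> \bar R, measurable_fun [set: T] f -> (forall t, 0 <= f t)%E ->
  (\int[nu]_t f t = \int[mu]_t (f t * (g t)%:E))%E.
Proof.
move=> mg g0 nuE f mf f0.
pose h := nnsfun_approx measurableT mf.
have hf x : (h n x)%:E @[n --> \oo] --> f x.
  by apply: cvg_nnsfun_approx.
have hnd x : nondecreasing_seq (h ^~ x).
  by move=> m n mn; exact/(lefP _ _ (nd_nnsfun_approx _ _ mn)).
transitivity (limn (fun n => \int[nu]_t (h n t)%:E))%E.
{ rewrite -monotone_convergence//=.
  - by apply: eq_integral => t _; apply/esym/cvg_lim => //; exact: hf.
  - by move=> n; apply/measurable_EFinP.
  - by move=> n t _; rewrite lee_fin.
  - by move=> t _ m n mn; rewrite lee_fin hnd. }
have hg n : (\int[nu]_t (h n t)%:E = \int[mu]_t ((h n t)%:E * (g t)%:E))%E.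
  transitivity (\int[nu]_t
    (\sum_(y \in range (h n)) (y * \1_(h n @^-1` [set y]) t)%:E))%E.
    by apply: eq_integral => t tE; rewrite /= fimfunE -fsumEFin.
  rewrite ge0_integral_fsum//; last 2 first.
  - by move=> r; apply/measurable_EFinP/measurable_funM.
  - by move=> m y Ey; exact: nnfun_muleindic_ge0.
  transitivity (\int[mu]_t (\sum_(y \in range (h n))
    (y * \1_(h n @^-1` [set y]) t)%:E * (g t)%:E))%E; last first.
    under [RHS]eq_integral => x xE.
      rewrite fimfunE -fsumEFin //.
      rewrite ge0_mule_fsuml => [|y]; last exact: nnfun_muleindic_ge0.
      over.
    by [].
  rewrite ge0_integral_fsum//; last 2 first.
  - move=> y; apply: emeasurable_funM => //; apply/measurable_EFinP => //.
    exact: measurable_funM.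
  - by move=> m y Ey; apply: mule_ge0; [exact: nnfun_muleindic_ge0|rewrite lee_fin].
  apply: eq_fsbigr => r rhn.
  under [LHS]eq_integral do rewrite EFinM.
  rewrite integralZl_indic_nnsfun => //.
  under [RHS]eq_integral do rewrite EFinM -muleA.
  rewrite [RHS]ge0_integralZl//.
  - rewrite integral_indic// setIT nuE// integral_mkcond.
    congr (_ * _)%E; apply: eq_integral => x _.
    by rewrite epatch_indic muleC.
  - by apply: emeasurable_funM; apply/measurable_EFinP.
  - by move=> t Et; rewrite mule_ge0 ?lee_fin.
  - by move: rhn; rewrite inE => -[t _ <-]; rewrite lee_fin.
under eq_fun do rewrite hg.
rewrite -monotone_convergence//=.
- apply: eq_integral => t _; apply/cvg_lim => //.
  apply: cvgeZr => //.
- by move=> n; apply: emeasurable_funM => //; exact/measurable_EFinP.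
- by move=> n t _; rewrite -EFinM lee_fin mulr_ge0.
- by move=> t _ m n mn; rewrite -!EFinM lee_fin ler_wpM2r// hnd.
Qed.

Lemma exists_density (R : realType) (d : measure_display)
    (T : measurableType d) (mu : {measure set T -> \bar R}) (g : T -> R) :
  measurable_fun setT g -> (forall t, 0 <= g t) ->
  exists nu : {measure set T -> \bar R},
    forall A, measurable A -> nu A = (\int[mu]_(t in A) (g t)%:E)%E.
Proof.
move=> mg g0.
pose nu := fun A : set T => (\int[mu]_(t in A) (g t)%:E)%E.
have nu0 : nu set0 = 0%E by rewrite /nu integral_set0.
have nu_ge0 A : (0 <= nu A)%E.
  by apply: integral_ge0 => t _; rewrite lee_fin.
have nu_add : semi_sigma_additive nu.
  move=> F mF tF mUF; rewrite /nu ge0_integral_bigcup//=.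
  - by apply: is_cvg_ereal_nneg_natsum_cond => n _ _; exact: nu_ge0.
  - exact/measurable_EFinP/measurable_funTS.
  - by move=> t _; rewrite lee_fin.
pose mx := isMeasure.Build _ T R nu nu0 nu_ge0 nu_add.
pose M : {measure set T -> \bar R} := HB.pack nu mx.
by exists M.
Qed.

Lemma exists_pushforward (R : realType) (d1 d2 : measure_display)
    (X : measurableType d1) (Y : measurableType d2) (phi : X -> Y)
    (mu : {measure set X -> \bar R}) :
  measurable_fun setT phi ->
  exists2 nu : {measure set Y -> \bar R},
    (forall A, measurable A -> nu A = mu (phi @^-1` A)) &
    (forall f : Y -> \bar R, measurable_fun [set: Y] f ->
       (forall y, 0 <= f y)%E -> (\int[nu]_y f y = \int[mu]_x f (phi x))%E).
Proof.
move=> mphi.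
pose nu (A : set Y) := mu (phi @^-1` A).
have nu0 : nu set0 = 0%E by rewrite /nu preimage_set0 measure0.
have nu_ge0 A : (0 <= nu A)%E by rewrite measure_ge0.
have nu_add : semi_sigma_additive nu.
  move=> F mF tF mUF; rewrite /nu preimage_bigcup.
  have mpF i : measurable (phi @^-1` F i) by rewrite -[X in measurable X]setTI; exact: mphi.
  apply: measure_semi_sigma_additive => //.
    apply/trivIsetP => /= i j _ _ ij; rewrite -preimage_setI.
    by move/trivIsetP : tF => /(_ _ _ _ _ ij) ->//; rewrite preimage_set0.
  exact: bigcupT_measurable.
pose mx := isMeasure.Build _ Y R nu nu0 nu_ge0 nu_add.
pose M : {measure set Y -> \bar R} := HB.pack nu mx.
exists M => // f mf f0.
transitivity (\int[pushforward mu phi]_y f y)%E; first exact: eq_measure_integral.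
by rewrite ge0_integral_pushforward.
Qed.

(** * Laplace transforms of measures on the half-line *)

(** The Laplace variable is [l^2/2]: in terms of [l], the transforms below are
    built from the functions [expR (- (l * b))]. *)
Definition laplace_kernel (R : realType) (l t : R) : R :=
  expR (- (l ^+ 2 / 2 * t)).

Lemma measurable_laplace_kernel (R : realType) (l : R) :
  measurable_fun setT (fun t => (laplace_kernel l t)%:E).
Proof.
apply/measurable_EFinP; apply: measurableT_comp => //.
by apply: measurableT_comp => //; exact: measurable_funM.
Qed.

Lemma laplace_kernel_ge0 (R : realType) (l t : R) :
  (0 <= (laplace_kernel l t)%:E)%E.
Proof. by rewrite lee_fin expR_ge0. Qed.

Definition laplace_rep (R : realType) (m : {measure set R -> \bar R})
    (f : R -> R) : Prop :=
  m `]-oo, 0[%classic = 0%E /\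
  forall l : R, 0 < l -> (\int[m]_t (laplace_kernel l t)%:E = (f l)%:E)%E.

Definition laplace_transformed (R : realType) (f : R -> R) : Prop :=
  exists m : {measure set R -> \bar R}, laplace_rep m f.

Lemma laplace_rep_ge0 (R : realType) (m : {measure set R -> \bar R})
    (f : R -> R) l : laplace_rep m f -> 0 < l -> 0 <= f l.
Proof.
move=> [_ mf] l0; rewrite -lee_fin -mf//.
by apply: integral_ge0 => t _; exact: laplace_kernel_ge0.
Qed.

Lemma eq_laplace_rep (R : realType) (m : {measure set R -> \bar R})
    (f g : R -> R) : (forall l : R, 0 < l -> f l = g l) ->
  laplace_rep m f -> laplace_rep m g.
Proof. by move=> fg [m0 mf]; split=> // l l0; rewrite mf// fg. Qed.

(** The exponential Markov inequality:
    [1 <= expR (l^2/2 * (y - t))] on [t <= y]. *)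
Lemma laplace_rep_chernoff (R : realType) (m : {measure set R -> \bar R})
    (f : R -> R) (l y : R) : laplace_rep m f -> 0 < l ->
  (m `]-oo, y]%classic <= (expR (l ^+ 2 / 2 * y) * f l)%:E)%E.
Proof.
move=> [_ mf] l0.
rewrite EFinM -mf// -ge0_integralZl//; last 2 first.
- exact: measurable_laplace_kernel.
- by move=> t _; exact: laplace_kernel_ge0.
rewrite -[X in m X]setIT -integral_indic//.
apply: ge0_le_integral => //.
- by apply/measurable_EFinP.
- by apply: emeasurable_funM => //; exact: measurable_laplace_kernel.
- move=> t _; rewrite -EFinM lee_fin indicE.
  case: (boolP (t \in _)) => /=; last by rewrite mulr_ge0// expR_ge0.
  rewrite inE/= in_itv/= => ty.
  rewrite /laplace_kernel -expRD -mulrBr -[leLHS]expR0 ler_expR.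
  by rewrite mulr_ge0 ?divr_ge0 ?sqr_ge0// subr_ge0.
Qed.

(** A finite Laplace transform at one point already makes every half-line of
    finite mass; Fubini for convolutions needs this. *)
Lemma laplace_rep_sigma_finite (R : realType)
    (m : {measure set R -> \bar R}) (f : R -> R) :
  laplace_rep m f -> sigma_finite setT m.
Proof.
move=> mf; exists (fun n => `]-oo, n%:R]%classic).
  apply/seteqP; split=> // t _.
  exists (Num.truncn t).+1 => //=.
  by rewrite in_itv/= ltW// truncnS_gt.
move=> n; split=> //.
by apply: (le_lt_trans (laplace_rep_chernoff n%:R mf ltr01)); rewrite ltry.
Qed.

Lemma laplace_repD (R : realType) (m1 m2 : {measure set R -> \bar R})
    (f1 f2 : R -> R) : laplace_rep m1 f1 -> laplace_rep m2 f2 ->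
  laplace_rep (measure_add m1 m2) (fun l => f1 l + f2 l).
Proof.
move=> [m10 mf1] [m20 mf2]; split; first by rewrite [LHS]measure_addE m10 m20 adde0.
move=> l l0; rewrite ge0_integral_measure_add//; last 2 first.
- by move=> t _; exact: laplace_kernel_ge0.
- exact: measurable_laplace_kernel.
by rewrite mf1// mf2// EFinD.
Qed.

Lemma laplace_repZ (R : realType) (c : R) (c0 : 0 <= c)
    (m : {measure set R -> \bar R}) (f : R -> R) :
  laplace_rep m f -> laplace_rep (mscale (NngNum c0) m) (fun l => c * f l).
Proof.
move=> [m0 mf]; split.
  by change (c%:E * m `]-oo, 0%R[%classic = 0)%E; rewrite m0 mule0.
move=> l l0; rewrite ge0_integral_mscale//; last 2 first.
- exact: measurable_laplace_kernel.
- by move=> t _; exact: laplace_kernel_ge0.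
by rewrite mf// EFinM.
Qed.

Lemma eq_laplace_transformed (R : realType) (f g : R -> R) :
  (forall l : R, 0 < l -> f l = g l) ->
  laplace_transformed f -> laplace_transformed g.
Proof. by move=> fg [m mf]; exists m; apply: eq_laplace_rep mf. Qed.

Lemma laplace_transformedD (R : realType) (f g : R -> R) :
  laplace_transformed f -> laplace_transformed g ->
  laplace_transformed (fun l => f l + g l).
Proof.
move=> [m1 mf] [m2 mg]; exists (measure_add m1 m2).
exact: laplace_repD.
Qed.

Lemma laplace_transformedZ (R : realType) (c : R) (f : R -> R) : 0 <= c ->
  laplace_transformed f -> laplace_transformed (fun l => c * f l).
Proof.
by move=> c0 [m mf]; exists (mscale (NngNum c0) m); exact: laplace_repZ.
Qed.

Lemma laplace_transformed1 (R : realType) :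
  laplace_transformed (fun _ : R => 1).
Proof.
exists (\d_(0 : R)); split.
  by rewrite [LHS]diracE memNset//= in_itv/= ltxx.
move=> l l0; rewrite integral_dirac//; last exact: measurable_laplace_kernel.
by rewrite diracT mul1e /laplace_kernel mulr0 oppr0 expR0.
Qed.

(** Product measures are defined for bundled sigma-finite measures only. *)
Lemma exists_sigma_finite (R : realType) (d : measure_display)
    (T : measurableType d) (m : {measure set T -> \bar R}) :
  sigma_finite setT m ->
  exists M : {sigma_finite_measure set T -> \bar R}, forall A, M A = m A.
Proof.
case: m => mu [mu1 mu2] sf.
pose mx := Measure_isSigmaFinite.Build _ _ _
  (@Measure.Pack _ _ _ mu (@Measure.Class _ _ _ mu mu1 mu2)) sf.
pose M : {sigma_finite_measure set T -> \bar R} := HB.pack mu mx mu1 mu2.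
by exists M.
Qed.

Lemma eq_measure_laplace_rep (R : realType)
    (m1 m2 : {measure set R -> \bar R}) (f : R -> R) :
  (forall A, m2 A = m1 A) -> laplace_rep m1 f -> laplace_rep m2 f.
Proof.
move=> m12 [m0 mf]; split; first by rewrite m12.
by move=> l l0; rewrite -mf//; apply: eq_measure_integral => A _ _; exact: m12.
Qed.

(** A product of Laplace transforms is the transform of the convolution, the
    image of the product measure under addition. *)
Lemma laplace_transformedM (R : realType) (f1 f2 : R -> R) :
  laplace_transformed f1 -> laplace_transformed f2 ->
  laplace_transformed (fun l => f1 l * f2 l).
Proof.
move=> [m1 mf1] [m2 mf2].
have [M1 M1E] := exists_sigma_finite (laplace_rep_sigma_finite mf1).
have [M2 M2E] := exists_sigma_finite (laplace_rep_sigma_finite mf2).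
have M1f : laplace_rep M1 f1 by apply: eq_measure_laplace_rep mf1.
have M2f : laplace_rep M2 f2 by apply: eq_measure_laplace_rep mf2.
have madd : measurable_fun setT (fun p : R * R => p.1 + p.2).
  by apply: measurable_funD.
have [m mE mI] := exists_pushforward (M1 \x M2)%E madd.
exists m; split.
  rewrite mE//; apply/eqP; rewrite eq_le measure_ge0 andbT.
  have m10 : (M1 \x M2)%E (`]-oo, 0[%classic `*` setT) = 0%E.
    rewrite product_measure1E//; apply/eqP; rewrite mule_eq0; apply/orP; left.
    by apply/eqP; exact: M1f.1.
  have m20 : (M1 \x M2)%E (setT `*` `]-oo, 0[%classic) = 0%E.
    rewrite product_measure1E//; apply/eqP; rewrite mule_eq0; apply/orP; right.
    by apply/eqP; exact: M2f.1.
  apply: (@le_trans _ _ ((M1 \x M2)%E (`]-oo, 0[%classic `*` setT `|` setT `*` `]-oo, 0[%classic))).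
    apply: le_measure; rewrite ?inE//.
    - rewrite -[X in measurable X]setTI; exact: madd.
    - by apply: measurableU; exact: measurableX.
    - move=> [t u]/=; rewrite !in_itv/= => tu.
      by have [t0|t0] := ltP t 0; [left|right; split=> //=; rewrite ?in_itv/=; lra].
  apply: (le_trans (measureU2 _ _ _)); [exact: measurableX|exact: measurableX|].
  by rewrite -[leRHS]adde0; apply: leeD;
    [move: m10 => /eqP; rewrite eq_le => /andP[]//
    |move: m20 => /eqP; rewrite eq_le => /andP[]//].
move=> l l0; rewrite mI; last 2 first.
- exact: measurable_laplace_kernel.
- by move=> t; exact: laplace_kernel_ge0.
rewrite fubini_tonelli1/=; last 2 first.
- exact: (measurableT_comp (measurable_laplace_kernel l) madd).
- by move=> t; exact: laplace_kernel_ge0.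
rewrite /fubini_F/=.
under eq_integral => t _.
  under eq_integral => u _.
    rewrite /laplace_kernel mulrDr opprD expRD EFinM.
    rewrite -/(laplace_kernel l t) -/(laplace_kernel l u); over.
  rewrite ge0_integralZl//; last 3 first.
  - exact: measurable_laplace_kernel.
  - by move=> u _; exact: laplace_kernel_ge0.
  - exact: laplace_kernel_ge0.
  rewrite (M2f.2 l l0) muleC; over.
rewrite ge0_integralZl//; last 3 first.
- exact: measurable_laplace_kernel.
- by move=> u _; exact: laplace_kernel_ge0.
- by rewrite lee_fin (laplace_rep_ge0 M2f l0).
by rewrite (M1f.2 l l0) -EFinM mulrC.
Qed.

Lemma laplace_transformedX (R : realType) (f : R -> R) (n : nat) :
  laplace_transformed f -> laplace_transformed (fun l => f l ^+ n).
Proof.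
move=> mf; elim: n => [|n IH]; first exact: laplace_transformed1.
under [X in laplace_transformed X]eq_fun do rewrite exprS.
exact: laplace_transformedM.
Qed.

Lemma laplace_transformed_series (R : realType) (f : nat -> R -> R)
    (g : R -> R) :
  (forall n, laplace_transformed (f n)) ->
  (forall l : R, 0 < l -> series (fun n => f n l) @ \oo --> g l) ->
  laplace_transformed g.
Proof.
move=> /choice[m mf] fg; exists (mseries m 0); split.
  by apply: eseries0 => n _ _; exact: (mf n).1.
move=> l l0; rewrite ge0_integral_measure_series//; last 2 first.
- by move=> t _; exact: laplace_kernel_ge0.
- exact: measurable_laplace_kernel.
under eq_eseriesr do rewrite (mf _).2//.
apply/cvg_lim => //.
apply: cvg_EFin; first by apply: nearW => n; rewrite sumEFin.
apply: cvg_trans (fg l l0); apply: near_eq_cvg; apply: nearW => n.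
by rewrite /= sumEFin.
Qed.

(** Only nonnegative coefficients are allowed, since the measures are positive;
    this is what the logarithm and exponential series satisfy. *)
Lemma laplace_transformed_pseries (R : realType) (c : nat -> R) (f g : R -> R) :
  (forall n, 0 <= c n) -> laplace_transformed f ->
  (forall l : R, 0 < l -> series (fun n => c n * f l ^+ n) @ \oo --> g l) ->
  laplace_transformed g.
Proof.
move=> c0 mf cfg; apply: laplace_transformed_series cfg => n.
exact: laplace_transformedZ (laplace_transformedX _ mf).
Qed.

(** * Uniqueness of the Laplace transform *)

Lemma series_exp_coeff_le (R : realType) (z : R) K : 0 <= z ->
  series (exp_coeff z) K <= expR z.
Proof.
move=> z0; apply: nondecreasing_cvgn_le; last exact: is_cvg_series_exp_coeff.
by apply: nondecreasing_series => n _ _; exact: exp_coeff_ge0.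
Qed.

Lemma cvg_one_sub_expRN (R : realType) (z : R) :
  (fun K => - \sum_(k < K) (- z) ^+ k.+1 / k.+1`!%:R) @ \oo --> 1 - expR (- z).
Proof.
rewrite (_ : (fun K => _) = (fun K => 1 - series (exp_coeff (- z)) K.+1)).
  apply: cvgB; first exact: cvg_cst.
  have := @is_cvg_series_exp_coeff R (- z).
  by rewrite -(cvg_shiftS (series _)); apply.
apply/funext => K; rewrite seriesEnat/= big_nat_recl// /exp_coeff/=.
by rewrite expr0 fact0 divr1 opprD addNKr big_mkord.
Qed.

Lemma one_sub_expRN_sum_le (R : realType) (z : R) K : 0 <= z ->
  `|- \sum_(k < K) (- z) ^+ k.+1 / k.+1`!%:R| <= z * expR z.
Proof.
move=> z0; rewrite normrN (le_trans (ler_norm_sum _ _ _))//.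
apply: (@le_trans _ _ (z * series (exp_coeff z) K)); last first.
  by rewrite ler_wpM2l// series_exp_coeff_le.
rewrite seriesEord/= mulr_sumr; apply: ler_sum => k _.
rewrite normrM normrX normrN (ger0_norm z0) normfV normr_nat /exp_coeff/=.
rewrite exprS -mulrA ler_wpM2l// ler_wpM2l ?exprn_ge0//.
rewrite lef_pV2 ?posrE ?ltr0n ?fact_gt0// ler_nat factS leq_pmull//.
Qed.

(** The powers of [n exp (n (y - t))] are multiples of Laplace kernels in [t],
    so that power series in it without constant term can be integrated knowing
    only the Laplace transform. *)
Lemma exp_powers_laplace_kernel (R : realType) (n k : nat) (y t : R) :
  (n%:R * expR (n%:R * (y - t))) ^+ k.+1 =
  (n%:R * expR (n%:R * y)) ^+ k.+1 *
    laplace_kernel (Num.sqrt (2 * (n * k.+1)%:R)) t.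
Proof.
rewrite !exprMn -mulrA; congr (_ * _).
rewrite /laplace_kernel sqr_sqrtr ?mulr_ge0// -!expRM_natl -expRD; congr expR.
by rewrite natrM; field.
Qed.

(** A smooth approximation of the indicator of [t <= y]: as [n] grows,
    [n exp (n (y - t))] tends to infinity for [t <= y] (the factor [n] serves the
    endpoint [t = y]) and to [0] for [t > y].  As a series it has no constant term,
    so that it is integrable even for infinite measures. *)
Definition soft_step (R : realType) (n : nat) (y t : R) : R :=
  1 - expR (- (n%:R * expR (n%:R * (y - t)))).

Lemma measurable_soft_step (R : realType) (n : nat) (y : R) :
  measurable_fun setT (fun t => (soft_step n y t)%:E).
Proof.
apply/measurable_EFinP; apply: measurable_funB => //.
apply: measurableT_comp => //; apply: measurableT_comp => //.
apply: measurable_funM => //; apply: measurableT_comp => //.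
by apply: measurable_funM => //; exact: measurable_funB.
Qed.

Lemma integrable_laplace_kernel (R : realType) (m : {measure set R -> \bar R})
    (f : R -> R) (l : R) : laplace_rep m f -> 0 < l ->
  m.-integrable setT (fun t => (laplace_kernel l t)%:E).
Proof.
move=> [_ mf] l0; apply/integrableP; split; first exact: measurable_laplace_kernel.
under eq_integral do rewrite gee0_abs ?laplace_kernel_ge0//.
by rewrite mf// ltry.
Qed.

Lemma laplace_rep_ae (R : realType) (m : {measure set R -> \bar R})
    (f : R -> R) : laplace_rep m f -> {ae m, forall t, 0 <= t}.
Proof.
move=> [m0 _]; exists `]-oo, 0[%classic; split=> //.
by move=> t/= /negP; rewrite -ltNge in_itv.
Qed.

Lemma integral_soft_step_sum (R : realType) (m : {measure set R -> \bar R})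
    (f : R -> R) (n : nat) (y : R) K : laplace_rep m f -> (0 < n)%N ->
  let c k := - ((- (n%:R * expR (n%:R * y))) ^+ k.+1 / k.+1`!%:R) in
  let l k := Num.sqrt (2 * (n * k.+1)%:R) in
  m.-integrable setT
    (fun t => (\sum_(k < K) c k * laplace_kernel (l k) t)%:E) /\
  (\int[m]_t (\sum_(k < K) c k * laplace_kernel (l k) t)%:E =
    (\sum_(k < K) c k * f (l k))%:E)%E.
Proof.
move=> mf n0 c l.
have l0 k : 0 < l k by rewrite sqrtr_gt0 mulr_gt0// ltr0n muln_gt0 n0.
have ik k : m.-integrable setT (fun t => (c k * laplace_kernel (l k) t)%:E).
  under eq_fun do rewrite EFinM.
  by apply: integrableZl => //; exact: integrable_laplace_kernel mf (l0 k).
elim: K => [|K [IH1 IH2]].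
  under eq_fun do rewrite big_ord0; split; first exact: integrable0.
  by rewrite integral0 big_ord0.
under eq_fun do rewrite big_ord_recr/= EFinD; split; first exact: integrableD.
rewrite integralD// IH2 big_ord_recr/= EFinD; congr (_ + _)%E.
under eq_integral do rewrite EFinM.
rewrite integralZl//; last exact: integrable_laplace_kernel mf (l0 K).
by rewrite mf.2// EFinM.
Qed.

(** The left-hand side only involves the transform [f], hence the integral of
    [soft_step n y] is determined by [f].  The partial sums of
    [1 - exp (- z)] are dominated by [z exp z], and on [t >= 0] the factor [z] is
    itself a multiple of an integrable Laplace kernel. *)
Lemma integral_soft_step (R : realType) (m : {measure set R -> \bar R})
    (f : R -> R) (n : nat) (y : R) : laplace_rep m f -> (0 < n)%N ->
  (\sum_(k < K) - ((- (n%:R * expR (n%:R * y))) ^+ k.+1 / k.+1`!%:R) *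
     f (Num.sqrt (2 * (n * k.+1)%:R)))%:E @[K --> \oo] -->
  (\int[m]_t (soft_step n y t)%:E)%E.
Proof.
move=> mf n0.
have H K := integral_soft_step_sum y K mf n0.
rewrite /= in H.
under eq_cvg do rewrite -(H _).2.
pose z0 := n%:R * expR (n%:R * y) : R.
have z00 : 0 <= z0 by rewrite mulr_ge0// expR_ge0.
have sumE K t : \sum_(k < K) - ((- z0) ^+ k.+1 / k.+1`!%:R) *
    laplace_kernel (Num.sqrt (2 * (n * k.+1)%:R)) t =
    - \sum_(k < K) (- (n%:R * expR (n%:R * (y - t)))) ^+ k.+1 / k.+1`!%:R.
  rewrite -sumrN; apply: eq_bigr => k _; rewrite mulNr; congr (- _).
  rewrite (exprNn z0) (exprNn (n%:R * _)) (exp_powers_laplace_kernel n k y t) -/z0.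
  by rewrite -!mulrA [_^-1 * _]mulrC.
have [] := @dominated_convergence _ _ R m setT measurableT
  (fun K t => (\sum_(k < K) - ((- z0) ^+ k.+1 / k.+1`!%:R) *
     laplace_kernel (Num.sqrt (2 * (n * k.+1)%:R)) t)%:E)
  (fun t => (soft_step n y t)%:E)
  (fun t => ((z0 * expR z0)%:E * (laplace_kernel (Num.sqrt (2 * n%:R)) t)%:E)%E).
- by move=> K; have /integrableP[] := (H K).1.
- exact: measurable_soft_step.
- apply: aeW => t _; apply: cvg_EFin; first exact: nearW.
  have := @cvg_one_sub_expRN R (n%:R * expR (n%:R * (y - t))).
  apply: cvg_trans; apply: near_eq_cvg; apply: nearW => K.
  by rewrite /= sumE.
- apply: integrableZl => //; apply: integrable_laplace_kernel mf _.
  by rewrite sqrtr_gt0 mulr_gt0// ltr0n.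
- apply: filterS (laplace_rep_ae mf) => t t0 K _.
  have := exp_powers_laplace_kernel n 0 y t; rewrite !expr1 muln1 => zE.
  have kle : laplace_kernel (Num.sqrt (2 * n%:R)) t <= 1.
    rewrite /laplace_kernel -expR0 ler_expR oppr_le0 mulr_ge0// divr_ge0// sqr_ge0.
  rewrite abse_EFin -EFinM lee_fin sumE.
  apply: (le_trans (one_sub_expRN_sum_le _ _)).
    by rewrite mulr_ge0// expR_ge0.
  rewrite [leRHS]mulrAC -zE ler_wpM2l//.
  by rewrite ler_expR zE -[leRHS]mulr1 ler_wpM2l.
by [].
Qed.

Lemma soft_step_ge0 (R : realType) (n : nat) (y t : R) : 0 <= soft_step n y t.
Proof.
by rewrite subr_ge0 -[leRHS]expR0 ler_expR oppr_le0 mulr_ge0// expR_ge0.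
Qed.

Lemma soft_step_le (R : realType) (n : nat) (y t : R) :
  soft_step n y t <= n%:R * expR (n%:R * (y - t)).
Proof.
by rewrite /soft_step lerBlDl -lerBlDr; exact: expR_ge1Dx.
Qed.

(** A bound uniform in [n], integrable because it is a multiple of the Laplace
    kernel at [l = sqrt 2]. *)
Lemma soft_step_dominated (R : realType) (n : nat) (y t : R) : (0 < n)%N ->
  soft_step n y t <= expR (1 + (y - t)).
Proof.
move=> n0; have [ty|ty] := lerP 0 (1 + (y - t)).
  apply: (@le_trans _ _ 1); last by rewrite -[leLHS]expR0 ler_expR.
  by rewrite lerBlDr lerDl expR_ge0.
apply: le_trans (soft_step_le _ _ _) _.
have n1 : 1 <= n%:R :> R by rewrite ler1n.
(* since y - t < -1, the exponent n - 1 + n (y - t) is at most 1 + (y - t) *)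
have nle : n%:R <= expR (n%:R - 1) :> R.
  by apply: le_trans (expR_ge1Dx _); rewrite addrC subrK.
apply: (@le_trans _ _ (expR (n%:R - 1) * expR (n%:R * (y - t)))).
  by rewrite ler_wpM2r// expR_ge0.
rewrite -expRD ler_expR; nra.
Qed.

Lemma cvg_soft_step (R : realType) (y t : R) :
  soft_step n.+1 y t @[n --> \oo] --> (\1_(`]-oo, y]) t : R).
Proof.
have [ty|ty] := lerP t y; rewrite indicE.
  rewrite mem_set/= ?in_itv//= -[X in _ --> X]subr0.
  apply: cvgB; first exact: cvg_cst.
  apply: (@squeeze_cvgr _ _ _ _ (cst 0) harmonic); last 2 first.
  - exact: cvg_cst.
  - exact: cvg_harmonic.
  apply: nearW => n; rewrite expR_ge0/= expRN lef_pV2 ?posrE ?expR_gt0//.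
  apply: (@le_trans _ _ (expR (n.+1%:R))); last first.
    rewrite ler_expR ler_peMr// -[leLHS]expR0 ler_expR mulr_ge0// subr_ge0//.
  by apply: le_trans (expR_ge1Dx _); rewrite lerDr.
rewrite memNset/= ?in_itv/= -?ltNge//.
have d0 : 0 < t - y by rewrite subr_gt0.
apply: (@squeeze_cvgr _ _ _ _ (cst 0)
  (fun n => (4 / (t - y) ^+ 2) * harmonic n)); last 2 first.
- exact: cvg_cst.
- rewrite -[X in _ --> X](mulr0 (4 / (t - y) ^+ 2)).
  apply: cvgM; [exact: cvg_cst|exact: cvg_harmonic].
apply: nearW => n; rewrite soft_step_ge0/=.
apply: le_trans (soft_step_le _ _ _) _.
set N := n.+1%:R : R; have N0 : 0 < N by rewrite ltr0n.
(* quadratic growth of the exponential beats the prefactor N *)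
have E : (N * (t - y) / 2) ^+ 2 <= expR (N * (t - y)).
  rewrite [X in expR X](_ : _ = 2%:R * (N * (t - y) / 2)); last by field.
  rewrite expRM_natl ler_sqr ?nnegrE ?expR_ge0 ?divr_ge0 ?mulr_ge0 ?ltW//.
  by apply: lt_le_trans (expR_ge1Dx _); rewrite ltrDr.
rewrite -(opprB t y) mulrN expRN.
apply: (@le_trans _ _ (N * ((N * (t - y) / 2) ^+ 2)^-1)).
  rewrite ler_wpM2l ?(ltW N0)// lef_pV2 ?posrE ?expR_gt0// exprn_gt0//.
  by rewrite divr_gt0// mulr_gt0.
rewrite le_eqVlt; apply/orP; left; apply/eqP; rewrite /N; field.
  by rewrite -/N !gt_eqF.
by apply/negP; rewrite -ltNge.
Qed.

Lemma cvg_integral_soft_step (R : realType) (m : {measure set R -> \bar R})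
    (f : R -> R) (y : R) : laplace_rep m f ->
  (\int[m]_t (soft_step n.+1 y t)%:E)%E @[n --> \oo] --> m `]-oo, y]%classic.
Proof.
move=> mf.
have [] := @dominated_convergence _ _ R m setT measurableT
  (fun n t => (soft_step n.+1 y t)%:E)
  (fun t => (\1_(`]-oo, y]) t)%:E)
  (fun t => ((expR (1 + y))%:E * (laplace_kernel (Num.sqrt 2) t)%:E)%E).
- by move=> n; exact: measurable_soft_step.
- exact/measurable_EFinP.
- apply: aeW => t _; apply: cvg_EFin; first exact: nearW.
  exact: cvg_soft_step.
- apply: integrableZl => //; apply: integrable_laplace_kernel mf _.
  by rewrite sqrtr_gt0.
- apply: aeW => t n _; rewrite abse_EFin -EFinM lee_fin ger0_norm ?soft_step_ge0//.
  apply: (le_trans (soft_step_dominated y t (ltn0Sn n))).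
  rewrite /laplace_kernel sqr_sqrtr// -expRD ler_expR; lra.
by move=> _ _; rewrite integral_indic// setIT.
Qed.

(** The integrals of [soft_step n y] depend on the transform only, and they
    converge to the mass of [t <= y]. *)
Lemma laplace_rep_unique (R : realType) (m1 m2 : {measure set R -> \bar R})
    (f : R -> R) (y : R) : laplace_rep m1 f -> laplace_rep m2 f ->
  m1 `]-oo, y]%classic = m2 `]-oo, y]%classic.
Proof.
move=> mf1 mf2.
have E n : (\int[m1]_t (soft_step n.+1 y t)%:E =
            \int[m2]_t (soft_step n.+1 y t)%:E)%E.
  have h1 := integral_soft_step (y := y) mf1 (ltn0Sn n).
  have h2 := integral_soft_step (y := y) mf2 (ltn0Sn n).
  exact: (cvg_unique (@ereal_hausdorff R) h1 h2).
have := cvg_integral_soft_step (y := y) mf1; under eq_fun do rewrite E.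
by move=> H; exact: (cvg_unique (@ereal_hausdorff R) H (cvg_integral_soft_step (y := y) mf2)).
Qed.

(** Stated with two summands on each side, so that an identity between
    differences of transforms can be used although the measures are positive. *)
Lemma laplace_rep_unique_add (R : realType)
    (m1 m2 m3 m4 : {measure set R -> \bar R}) (f1 f2 f3 f4 : R -> R) (y : R) :
  laplace_rep m1 f1 -> laplace_rep m2 f2 ->
  laplace_rep m3 f3 -> laplace_rep m4 f4 ->
  (forall l : R, 0 < l -> f1 l + f2 l = f3 l + f4 l) ->
  (m1 `]-oo, y]%classic + m2 `]-oo, y]%classic =
   m3 `]-oo, y]%classic + m4 `]-oo, y]%classic)%E.
Proof.
move=> mf1 mf2 mf3 mf4 fE; rewrite -2!measure_addE.
apply: laplace_rep_unique (laplace_repD mf3 mf4).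
by apply: eq_laplace_rep (laplace_repD mf1 mf2).
Qed.

(** * The normal distribution function *)

(** This is [normal_pdf 0 1] without the case distinction on the standard
    deviation. *)
Definition std_normal_pdf (R : realType) (z : R) : R :=
  (Num.sqrt (2 * pi))^-1 * expR (- (z ^+ 2 / 2)).

Lemma normal_pdf01E (R : realType) (z : R) :
  normal_pdf 0 1 z = std_normal_pdf z.
Proof.
rewrite normal_pdfE ?oner_neq0// /normal_peak /normal_fun /std_normal_pdf subr0 expr1n.
by rewrite mul1r mulr_natl mulNr.
Qed.

Lemma std_normal_pdf_gt0 (R : realType) (z : R) : 0 < std_normal_pdf z.
Proof. by rewrite mulr_gt0 ?expR_gt0// invr_gt0 sqrtr_gt0 mulr_gt0// pi_gt0. Qed.

Lemma continuous_std_normal_pdf (R : realType) : continuous (@std_normal_pdf R).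
Proof.
rewrite (_ : @std_normal_pdf R = normal_pdf 0 1).
  exact: continuous_normal_pdf (oner_neq0 R).
by apply/funext => z; rewrite normal_pdf01E.
Qed.

Lemma measurable_std_normal_pdf (R : realType) :
  measurable_fun setT (@std_normal_pdf R).
Proof. exact: continuous_measurable_fun (@continuous_std_normal_pdf R). Qed.

Lemma integrable_std_normal_pdf (R : realType) :
  (@lebesgue_measure R).-integrable setT (EFin \o @std_normal_pdf R).
Proof.
have := integrable_normal_pdf (0 : R) 1.
by apply: eq_integrable => // z _; rewrite normal_pdf01E.
Qed.

Definition std_normal_cdf (R : realType) (z : R) : R :=
  \int[lebesgue_measure]_(t in `]-oo, z]) std_normal_pdf t.

Lemma is_derive_std_normal_cdf (R : realType) (z : R) :
  is_derive z 1 (@std_normal_cdf R) (std_normal_pdf z).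
Proof.
have zz1 : z < z + 1 by rewrite ltrDl.
have [] := @continuous_FTC1 R (@std_normal_pdf R) -oo%O z (z + 1) zz1 _ _ _.
- exact: integrableS (@integrable_std_normal_pdf R).
- by rewrite ltNyr.
- exact: continuous_std_normal_pdf.
by move=> dF <-; rewrite derive1E; apply: DeriveDef.
Qed.

Lemma std_normal_cdfE (R : realType) (z : R) :
  (std_normal_cdf z)%:E = normal_prob 0 1 `]-oo, z]%classic.
Proof.
rewrite /std_normal_cdf /Rintegral fineK.
  by apply: eq_integral => t _; rewrite normal_pdf01E.
apply: integrable_fin_num => //.
exact: integrableS (@integrable_std_normal_pdf R).
Qed.

Lemma std_normal_cdf_lim (R : realType) :
  @std_normal_cdf R z @[z --> +oo] --> (1 : R) /\
  @std_normal_cdf R z @[z --> -oo] --> (0 : R).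
Proof.
pose mx := @isMeasurableFun.Build _ _ (measurableTypeR R) R idfun (@measurable_id _ _ setT).
pose X : {RV (normal_prob (0 : R) 1) >-> R} := HB.pack (idfun : R -> R) mx.
have cdfE z : cdf X z = (std_normal_cdf z)%:E by rewrite std_normal_cdfE.
have NE : fine \o cdf X = @std_normal_cdf R.
  by apply/funext => z; exact: (congr1 fine (cdfE z)).
by rewrite -NE; split; apply: fine_cvg; [exact: cvg_cdfy1|exact: cvg_cdfNy0].
Qed.

(** The half-line is exhausted from the left by closed half-lines, so that
    [F] only needs a limit at [a]; the antiderivatives below contain [c / z],
    singular at [0]. *)
Lemma ge0_FTC_oy (R : realType) (f F : R -> R) (a l0 l : R) :
  (forall x, a < x -> 0 <= f x) ->
  (forall x, a < x -> {for x, continuous f}) ->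
  (forall x, a < x -> is_derive x 1 F (f x)) ->
  F x @[x --> a^'+] --> l0 -> F x @[x --> +oo] --> l ->
  (\int[lebesgue_measure]_(x in `]a, +oo[) (f x)%:E = (l - l0)%:E)%E.
Proof.
move=> f0 cf dF Fl0 Fl.
pose u n : R := a + n.+1%:R^-1.
have ua n : a < u n by rewrite ltrDl invr_gt0.
have mf : measurable_fun `]a, +oo[ (fun x => (f x)%:E).
  apply/measurable_EFinP; apply: open_continuous_measurable_fun => //.
  by move=> x; rewrite inE/= in_itv/= andbT; exact: cf.
have usub n : `[u n, +oo[%classic `<=` `]a, +oo[%classic.
  by move=> x/=; rewrite !in_itv/= !andbT; exact: lt_le_trans.
have -> : `]a, +oo[%classic = \bigcup_n `[u n, +oo[%classic.
  apply/seteqP; split => [x/=|x [n _]]; last exact: usub.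
  rewrite in_itv/= andbT => ax.
  have xa : 0 < x - a by rewrite subr_gt0.
  exists (Num.truncn (x - a)^-1) => //=; rewrite in_itv/= andbT.
  rewrite /u -lerBrDl -[leRHS]invrK lef_pV2 ?posrE ?invr_gt0// ltW// truncnS_gt//.
have cvgu := @ge0_nondecreasing_set_cvg_integral _ (measurableTypeR R) R
  (fun n => `[u n, +oo[%classic) (fun x => (f x)%:E) lebesgue_measure.
apply: (cvg_unique (@ereal_hausdorff R) (cvgu _ _ _ _)).
- move=> n m nm; apply/subsetPset => x/=; rewrite !in_itv/= !andbT.
  by apply: le_trans; rewrite lerD2l lef_pV2 ?posrE// ler_nat.
- by [].
- by move=> n; exact: measurable_funS (usub n) mf.
- by move=> n x /usub/=; rewrite in_itv/= andbT lee_fin; exact: f0.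
have E n : (\int[lebesgue_measure]_(x in `[u n, +oo[) (f x)%:E = (l - F (u n))%:E)%E.
  rewrite (@ge0_continuous_FTC2y _ f F _ l)//.
  - by move=> x ux; apply: f0; exact: lt_le_trans ux.
  - apply: continuous_in_subspaceT => x; rewrite inE/= in_itv/= andbT => ux.
    by apply: cf; exact: lt_le_trans ux.
  - by move=> x ux; have [] := dF x (lt_trans (ua n) ux).
  - apply: cvg_at_right_filter.
    have : derivable F (u n) 1 by have [] := dF _ (ua n).
    by move=> /derivable1_diffP/differentiable_continuous.
  - move=> x; rewrite in_itv/= andbT => ux.
    by rewrite derive1E; have [_ ->] := dF x (lt_trans (ua n) ux).
rewrite /=; under eq_cvg do rewrite E.
apply: cvg_EFin; first exact: nearW.
apply: cvgB; first exact: cvg_cst.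
move/cvg_at_rightP : Fl0; apply; split => //.
rewrite -[X in _ --> X]addr0; apply: cvgD; first exact: cvg_cst.
exact: cvg_harmonic.
Qed.

(** * Laplace transforms of inverse square normal laws *)

(** The cross term of [(z + s / z)^2 = z^2 + 2 s + s^2 / z^2] does not depend on
    [z]: up to a constant, the densities at [z + c / z] and [z - c / z] coincide,
    which is what makes the integrals below elementary. *)
Lemma std_normal_pdf_shift (R : realType) (s z : R) : z != 0 ->
  std_normal_pdf (z + s / z) =
  std_normal_pdf z * expR (- (s ^+ 2 / (2 * z ^+ 2))) * expR (- s).
Proof.
move=> z0; rewrite /std_normal_pdf -!mulrA -!expRD; congr (_ * expR _).
by field.
Qed.

Lemma is_derive_std_normal_cdf_shift (R : realType) (s z : R) : z != 0 ->
  is_derive z 1 (fun z => std_normal_cdf (z + s / z))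
    (std_normal_pdf z * expR (- (s ^+ 2 / (2 * z ^+ 2))) * expR (- s) *
     (1 - s / z ^+ 2)).
Proof.
move=> z0; rewrite -std_normal_pdf_shift//.
have dz : is_derive z 1 (fun z => z + s / z) (1 - s / z ^+ 2).
  have dV : is_derive z 1 (fun z : R => z^-1) (- z ^- 2 *: 1).
    exact: is_deriveV.
  have dsV : is_derive z 1 (fun z : R => s * z^-1) (s *: (- z ^- 2 *: 1)).
    exact: is_deriveZ.
  apply: is_derive_eq.
  by rewrite /GRing.scale/= mulr1 mulrN.
exact: (@is_derive1_comp R (@std_normal_cdf R) (fun z => z + s / z) z _ _
  (is_derive_std_normal_cdf (z + s / z)) dz).
Qed.

Lemma cvg_shift_y (R : realType) (s : R) :
  z + s / z @[z --> +oo] --> +oo.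
Proof.
apply/cvgryPge => A.
near=> z.
have z1 : 1 <= z by near: z; exact: nbhs_pinfty_ge (num_real _).
have zA : A + `|s| <= z by near: z; exact: nbhs_pinfty_ge (num_real _).
have z0 : 0 < z by exact: lt_le_trans z1.
have : - `|s| <= s / z.
  rewrite lerNl -mulNr ler_pdivrMr//.
  apply: (@le_trans _ _ `|s|); last by rewrite ler_peMr.
  by rewrite -normrN ler_norm.
lra.
Unshelve. all: by end_near. Qed.

Lemma cvg_shift_0 (R : realType) (s : R) : 0 < s ->
  z + s / z @[z --> 0^'+] --> +oo /\ z + - s / z @[z --> 0^'+] --> -oo.
Proof.
move=> s0.
have H A : \forall z \near (0 : R)^'+, [/\ 0 < z, z <= 1 & `|A| + 1 <= s / z].
  have A0 : 0 < `|A| + 1 by rewrite ltr_wpDl.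
  near=> z; have z0 : 0 < z by near: z; exact: nbhs_right_gt.
  split=> //; first by near: z; exact: nbhs_right_le.
  rewrite ler_pdivlMr// mulrC -ler_pdivlMr//.
  by near: z; apply: nbhs_right_le; rewrite divr_gt0.
split.
- apply/cvgryPge => A; near=> z.
  have [z0 z1 zA] : [/\ 0 < z, z <= 1 & `|A| + 1 <= s / z] by near: z; exact: H.
  by have := ler_norm A; lra.
- apply/cvgrNyPle => A; near=> z.
  have [z0 z1 zA] : [/\ 0 < z, z <= 1 & `|A| + 1 <= s / z] by near: z; exact: H.
  by have := ler_norm (- A); rewrite normrN mulNr; lra.
Unshelve. all: by end_near. Qed.

Definition std_normal_damped (R : realType) (c z : R) : R :=
  std_normal_pdf z * expR (- (c ^+ 2 / (2 * z ^+ 2))).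

Lemma std_normal_damped_ge0 (R : realType) (c z : R) :
  0 <= std_normal_damped c z.
Proof. by rewrite mulr_ge0 ?expR_ge0// ltW// std_normal_pdf_gt0. Qed.

Lemma continuous_std_normal_damped (R : realType) (c z : R) : z != 0 ->
  {for z, continuous (std_normal_damped c)}.
Proof.
move=> z0; apply: continuousM; first exact: continuous_std_normal_pdf.
apply: (@continuous_comp _ _ _ (fun z : R => - (c ^+ 2 / (2 * z ^+ 2))) expR).
  apply: continuousN; apply: continuousM; first exact: cst_continuous.
  apply: continuousV; first by rewrite mulf_neq0// expf_neq0.
  apply: continuousM; first exact: cst_continuous.
  exact: exprn_continuous.
exact: continuous_expR.
Qed.

Lemma cvg_shift_cdf (R : realType) (s : R) : 0 < s ->
  [/\ std_normal_cdf (z + s / z) @[z --> +oo] --> (1 : R),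
      std_normal_cdf (z + - s / z) @[z --> +oo] --> (1 : R),
      std_normal_cdf (z + s / z) @[z --> 0^'+] --> (1 : R) &
      std_normal_cdf (z + - s / z) @[z --> 0^'+] --> (0 : R)].
Proof.
move=> s0; have [N1 N0] := std_normal_cdf_lim R.
have [sy sNy] := cvg_shift_0 s0.
split.
- exact: cvg_comp (@cvg_shift_y R s) N1.
- exact: cvg_comp (@cvg_shift_y R (- s)) N1.
- exact: cvg_comp sy N1.
- exact: cvg_comp sNy N0.
Qed.

(** The antiderivative is
    [exp (- c) Phi (z - c / z) + exp c Phi (z + c / z)], where [Phi] is the normal
    distribution function; the terms in [c / z^2] of the two derivatives cancel. *)
Lemma integral_std_normal_damped (R : realType) (c : R) : 0 < c ->
  (\int[lebesgue_measure]_(z in `]0%R, +oo[) (2 * std_normal_damped c z)%:E =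
   (expR (- c))%:E)%E.
Proof.
move=> c0; have [p1 p2 p3 p4] := cvg_shift_cdf c0.
pose F z := expR (- c) * std_normal_cdf (z + - c / z) +
            expR c * std_normal_cdf (z + c / z).
have -> : expR (- c) = expR (- c) * 1 + expR c * 1 -
   (expR (- c) * 0 + expR c * 1) :> R by ring.
apply: (@ge0_FTC_oy R _ F).
- by move=> z _; rewrite mulr_ge0// std_normal_damped_ge0.
- move=> z z0; apply: continuousM; first exact: cst_continuous.
  by apply: continuous_std_normal_damped; rewrite gt_eqF.
- move=> z z0; have zn0 : z != 0 by rewrite gt_eqF.
  have d1 := is_derive_std_normal_cdf_shift c zn0.
  have d2 := is_derive_std_normal_cdf_shift (- c) zn0.
  have d := is_deriveD (is_deriveZ (expR (- c)) d2) (is_deriveZ (expR c) d1).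
  have {d1 d2}d : is_derive z 1 F _ := d.
  apply: is_derive_eq; rewrite /GRing.scale/= /std_normal_damped sqrrN opprK.
  rewrite (mulrC _ (expR c)) (mulrC _ (expR (- c))) !mulrA -!expRD addNr addrN expR0.
  by rewrite !mul1r mulNr; ring.
- by apply: cvgD; apply: cvgM => //; exact: cvg_cst.
- by apply: cvgD; apply: cvgM => //; exact: cvg_cst.
Qed.

Lemma is_derive_id_std_normal_damped (R : realType) (c z : R) : z != 0 ->
  is_derive z 1 (fun z => z * std_normal_damped c z)
    (std_normal_damped c z * (1 - z ^+ 2 + c ^+ 2 / z ^+ 2)).
Proof.
move=> z0.
pose u (z : R) := - (z ^+ 2 / 2) - c ^+ 2 / 2 * (z ^+ 2)^-1.
have du : is_derive z 1 u (- z + c ^+ 2 / z ^+ 3).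
  have dX : is_derive z 1 (fun z : R => z ^+ 2) (2 * z).
    by apply: is_derive_eq; rewrite /GRing.scale/=; ring.
  have z20 : z ^+ 2 != 0 by rewrite expf_neq0.
  have dV := @is_deriveV R (fun z : R => z ^+ 2) z (2 * z) 1 z20 dX.
  have d1 := is_deriveD (is_deriveZ (- 2^-1) dX) (is_deriveZ (- (c ^+ 2 / 2)) dV).
  have uE : u = (fun x => - 2^-1 *: x ^+ 2 + - (c ^+ 2 / 2) *: (x ^+ 2)^-1).
    by apply/funext => w; rewrite /u /GRing.scale/= mulNr mulNr (mulrC 2^-1).
  rewrite uE; apply: (is_derive_eq d1).
  by rewrite /GRing.scale/=; field.
have de := is_derive1_comp (is_derive_expR (u z)) du.
have dd := is_deriveZ ((Num.sqrt (2 * pi))^-1) de.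
have dm := is_deriveM (@is_derive_id R R z 1) dd.
have dE w : std_normal_damped c w = (Num.sqrt (2 * pi))^-1 * expR (u w).
  rewrite /std_normal_damped /std_normal_pdf -mulrA -expRD; congr (_ * expR (_ - _)).
  by rewrite invfM mulrA.
rewrite (_ : (fun z => _) = (fun w => w * ((Num.sqrt (2 * pi))^-1 * expR (u w)))); last first.
  by apply/funext => w; rewrite dE.
apply: (is_derive_eq dm).
by rewrite /GRing.scale/= /GRing.scale/= dE; field; rewrite z0 sqrtr_eq0 -ltNge mulr_gt0 ?pi_gt0.
Qed.

Lemma cvg_id_std_normal_damped (R : realType) (c : R) :
  z * std_normal_damped c z @[z --> +oo] --> (0 : R) /\
  z * std_normal_damped c z @[z --> 0^'+] --> (0 : R).
Proof.
pose K : R := (Num.sqrt (2 * pi))^-1.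
have K0 : 0 <= K by rewrite invr_ge0 sqrtr_ge0.
have dle z : std_normal_damped c z <= K * expR (- (z ^+ 2 / 2)).
  rewrite /std_normal_damped -[leRHS]mulr1 ler_wpM2l//.
    by rewrite mulr_ge0// expR_ge0.
  by rewrite -[leRHS]expR0 ler_expR oppr_le0 divr_ge0// ?sqr_ge0// mulr_ge0// sqr_ge0.
split.
- apply: (@squeeze_cvgr _ _ _ _ (cst 0) (fun z => 2 * K * z^-1)); last 2 first.
  + exact: cvg_cst.
  + rewrite -[X in _ --> X](mulr0 (2 * K)); apply: cvgM; first exact: cvg_cst.
    apply/gtr0_cvgV0; last exact: cvg_id.
    by near=> z; near: z; exact: nbhs_pinfty_gt (num_real _).
  near=> z; have z0 : 0 < z by near: z; exact: nbhs_pinfty_gt (num_real _).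
  rewrite mulr_ge0 ?std_normal_damped_ge0 ?(ltW z0)//=.
  apply: (@le_trans _ _ (z * (K * (z ^+ 2 / 2)^-1))).
    rewrite ler_wpM2l ?(ltW z0)//; apply: (le_trans (dle z)).
    rewrite ler_wpM2l// expRN lef_pV2 ?posrE ?expR_gt0 ?divr_gt0 ?exprn_gt0//.
    by apply: le_trans (expR_ge1Dx _); rewrite lerDr.
  by rewrite le_eqVlt; apply/orP; left; apply/eqP; field; rewrite gt_eqF.
- apply: (@squeeze_cvgr _ _ _ _ (cst 0) (fun z => z * K)); last 2 first.
  + exact: cvg_cst.
  + rewrite -[X in _ --> X](mul0r K); apply: cvgM; last exact: cvg_cst.
    exact: cvg_at_right_filter (@cvg_id _ _).
  near=> z; have z0 : 0 < z by near: z; exact: nbhs_right_gt.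
  rewrite mulr_ge0 ?std_normal_damped_ge0 ?(ltW z0)//=.
  rewrite ler_wpM2l ?(ltW z0)//; apply: (le_trans (dle z)).
  rewrite -[leRHS]mulr1 ler_wpM2l// -[leRHS]expR0 ler_expR oppr_le0 divr_ge0//.
  exact: sqr_ge0.
Unshelve. all: by end_near. Qed.

(** The antiderivative is [- 2 z] times the damped density plus a combination of
    [Phi (z - c / z)] and [Phi (z + c / z)], found by matching the powers of [z]
    in the derivative. *)
Lemma integral_sqr_std_normal_damped (R : realType) (c : R) : 0 < c ->
  (\int[lebesgue_measure]_(z in `]0%R, +oo[)
     (2 * z ^+ 2 * std_normal_damped c z)%:E =
   ((1 + c) * expR (- c))%:E)%E.
Proof.
move=> c0; have [p1 p2 p3 p4] := cvg_shift_cdf c0.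
have [q1 q2] := cvg_id_std_normal_damped c.
pose F z := - 2 * (z * std_normal_damped c z) +
  ((1 + c) * expR (- c) * std_normal_cdf (z + - c / z) +
   (1 - c) * expR c * std_normal_cdf (z + c / z)).
have e : (1 + c) * expR (- c) =
   (- 2 * 0 + ((1 + c) * expR (- c) * 1 + (1 - c) * expR c * 1)) -
   (- 2 * 0 + ((1 + c) * expR (- c) * 0 + (1 - c) * expR c * 1)) :> R by ring.
rewrite e; apply: (@ge0_FTC_oy R (fun z => 2 * z ^+ 2 * std_normal_damped c z)
  F 0 _ _) => {e}.
- move=> z _; rewrite mulr_ge0 ?std_normal_damped_ge0// mulr_ge0// sqr_ge0//.
- move=> z z0; apply: continuousM.
    by apply: continuousM; [exact: cst_continuous|exact: exprn_continuous].
  by apply: continuous_std_normal_damped; rewrite gt_eqF.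
- move=> z z0; have zn0 : z != 0 by rewrite gt_eqF.
  have d1 := is_derive_std_normal_cdf_shift c zn0.
  have d2 := is_derive_std_normal_cdf_shift (- c) zn0.
  have d3 := is_derive_id_std_normal_damped c zn0.
  have d := is_deriveD (is_deriveZ (- 2) d3)
    (is_deriveD (is_deriveZ ((1 + c) * expR (- c)) d2)
                (is_deriveZ ((1 - c) * expR c) d1)).
  have {d1 d2 d3}d : is_derive z 1 F _ := d.
  apply: is_derive_eq; rewrite /GRing.scale/= sqrrN opprK.
  rewrite -/(std_normal_damped c z).
  have e1 : expR (- c) * expR c = 1 by rewrite -expRD addNr expR0.
  rewrite (_ : (1 + c) * expR (- c) * _ =
    (1 + c) * (expR (- c) * expR c) * std_normal_damped c z * (1 + c / z ^+ 2)).
    rewrite (_ : (1 - c) * expR c * _ = (1 - c) * (expR (- c) * expR c) *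
       std_normal_damped c z * (1 - c / z ^+ 2)).
      by rewrite e1; field.
    by ring.
  by field.
- apply: cvgD; first by apply: cvgM => //; exact: cvg_cst.
  by apply: cvgD; apply: cvgM => //; exact: cvg_cst.
- apply: cvgD; first by apply: cvgM => //; exact: cvg_cst.
  by apply: cvgD; apply: cvgM => //; exact: cvg_cst.
Qed.

Lemma measurable_invr (R : realType) :
  measurable_fun setT (fun z : R => z^-1).
Proof.
have -> : [set: R] = [set 0 : R] `|` [set~ 0].
  by rewrite setUv.
apply/measurable_funU => //; first exact: measurableC.
split; first exact: measurable_fun_set1.
apply: open_continuous_measurable_fun; first
  exact/closed_openC/accessible_closed_set1/hausdorff_accessible/Rhausdorff.
by move=> z; rewrite inE/= => /eqP z0; exact: inv_continuous.
Qed.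

(** The image of the density [g] on [z > 0] under [z |-> b^2 / z^2].  If [g] is
    twice the normal density, this is the law of the hitting time of [b] by a
    Brownian motion started at [0]. *)
Lemma exists_inverse_square_law (R : realType) (b : R) (g : R -> R) :
  measurable_fun setT g -> (forall z, 0 <= g z) ->
  exists2 m : {measure set R -> \bar R},
    m `]-oo, 0[%classic = 0%E /\
    forall y : R, 0 < b -> 0 < y -> m `]-oo, y]%classic =
      (\int[lebesgue_measure]_(z in `[(b / Num.sqrt y)%R, +oo[) (g z)%:E)%E &
    forall l : R, (\int[m]_t (laplace_kernel l t)%:E =
      \int[lebesgue_measure]_(z in `]0%R, +oo[)
        (g z * expR (- ((l * b) ^+ 2 / (2 * z ^+ 2))))%:E)%E.
Proof.
move=> mg g0.
pose D : set R := `]0, +oo[%classic.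
pose h z : R := g z * \1_D z.
have mh : measurable_fun setT h by
  apply: measurable_funM => //; apply: measurable_indic; exact: measurable_itv.
have h0 z : 0 <= h z by rewrite mulr_ge0.
have [nu nuE] := exists_density (@lebesgue_measure R) mh h0.
pose phi (z : R) := b ^+ 2 * (z ^+ 2)^-1.
have mphi : measurable_fun setT phi.
  apply: measurable_funM => //.
  exact: (measurableT_comp (@measurable_invr R) (@exprn_measurable R setT 2)).
have [m mE mI] := exists_pushforward nu mphi.
exists m; first split.
- rewrite mE// (_ : _ @^-1` _ = set0).
    exact: measure0.
  apply/seteqP; split => // z/=; rewrite in_itv/= ltNge => /negP[].
  by rewrite mulr_ge0 ?invr_ge0 ?sqr_ge0.
- move=> y b0 y0; rewrite mE//.
  rewrite nuE; last by rewrite -[X in measurable X]setTI; exact: mphi.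
  rewrite [LHS]integral_mkcond [RHS]integral_mkcond; apply: eq_integral => z _.
  rewrite !patchE/= /h indicE.
  have sy0 : 0 < Num.sqrt y by rewrite sqrtr_gt0.
  have by0 : 0 < b / Num.sqrt y by rewrite divr_gt0.
  have [z0|z0] := leP z 0.
    rewrite [z \in D]memNset ?mulr0; last first.
      by rewrite /D/= in_itv/= andbT; apply/negP; rewrite -leNgt.
    rewrite [z \in `[_, +oo[%classic]memNset; last first.
      by rewrite /= in_itv/= andbT; apply/negP; rewrite -ltNge (le_lt_trans z0).
    by case: ifP.
  rewrite [z \in D]mem_set ?mulr1; last by rewrite /D/= in_itv/= andbT.
  suff -> : (z \in phi @^-1` `]-oo, y]%classic) =
            (z \in `[b / Num.sqrt y, +oo[%classic) by [].
  apply/idP/idP; rewrite !inE/= !in_itv/= ?andbT /phi.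
  - rewrite ler_pdivrMr ?exprn_gt0// ler_pdivrMr// => H.
    rewrite -ler_sqr ?nnegrE ?(ltW b0) ?mulr_ge0 ?(ltW z0) ?(ltW sy0)//.
    by rewrite exprMn sqr_sqrtr ?(ltW y0)// mulrC.
  - rewrite ler_pdivrMr// => H; rewrite ler_pdivrMr ?exprn_gt0//.
    rewrite -[X in X * _]sqr_sqrtr ?(ltW y0)// -exprMn mulrC.
    by rewrite ler_sqr ?nnegrE ?(ltW b0) ?mulr_ge0 ?(ltW z0) ?(ltW sy0).
- move=> l.
  have kE (w : R) : l ^+ 2 / 2 * (b ^+ 2 / w ^+ 2) = (l * b) ^+ 2 / (2 * w ^+ 2).
    by rewrite (invfM 2) exprMn; ring.
  rewrite mI; last 2 first.
  + exact: measurable_laplace_kernel.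
  + by move=> t; exact: laplace_kernel_ge0.
  rewrite (@integral_density R _ (measurableTypeR R) lebesgue_measure nu h mh h0 nuE); last 2 first.
  + exact: (measurableT_comp (measurable_laplace_kernel l) mphi).
  + by move=> t; exact: laplace_kernel_ge0.
  rewrite [RHS]integral_mkcond; apply: eq_integral => z _.
  rewrite patchE /h indicE -EFinM; case: ifPn => zD; last by rewrite !mulr0.
  rewrite mulr1 mulrC /laplace_kernel /phi; congr (_ * expR (- _))%:E.
  exact: kE.
Qed.

Lemma exists_laplace_rep_expR (R : realType) (b : R) : 0 < b ->
  exists2 m : {measure set R -> \bar R},
    laplace_rep m (fun l => expR (- (l * b))) &
    forall y : R, 0 < y -> m `]-oo, y]%classic =
      (\int[lebesgue_measure]_(z in `[(b / Num.sqrt y)%R, +oo[)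
        (2 * std_normal_pdf z)%:E)%E.
Proof.
move=> b0.
have mg : measurable_fun setT (fun z : R => 2 * std_normal_pdf z).
  by apply: measurable_funM => //; exact: measurable_std_normal_pdf.
have g0 (z : R) : 0 <= 2 * std_normal_pdf z.
  by rewrite mulr_ge0// ltW// std_normal_pdf_gt0.
have [m [m0 my] mI] := exists_inverse_square_law b mg g0.
exists m => [|y y0]; last exact: my.
split=> // l l0; rewrite mI -integral_std_normal_damped ?mulr_gt0//.
by apply: eq_integral => z _; rewrite -mulrA.
Qed.

(** Weighting the hitting time law by [b^2 / t = z^2] integrates its Laplace
    transform in [l^2/2], which gives [(1 + l b) exp (- l b)].  The function
    [l * expR (- (l * b))] alone vanishes at [l = 0] and is not monotone, hence is
    not a Laplace transform of a positive measure; adding [b^-1] to [l] repairs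
    this. *)
Lemma laplace_transformed_expR_affine (R : realType) (b : R) : 0 < b ->
  laplace_transformed (fun l => (l + b^-1) * expR (- (l * b))).
Proof.
move=> b0.
pose g (z : R) := 2 * z ^+ 2 * std_normal_pdf z / b.
have mg : measurable_fun setT g.
  apply: measurable_funM => //; apply: measurable_funM => //.
    by apply: measurable_funM.
  exact: measurable_std_normal_pdf.
have g0 z : 0 <= g z.
  apply: divr_ge0; last exact: ltW.
  by apply: mulr_ge0; [apply: mulr_ge0 => //; exact: sqr_ge0|exact/ltW/std_normal_pdf_gt0].
have [m [m0 _] mI] := exists_inverse_square_law b mg g0.
exists m; split=> // l l0; rewrite mI.
have -> : (l + b^-1) * expR (- (l * b)) =
    b^-1 * ((1 + l * b) * expR (- (l * b))).
  by field; rewrite gt_eqF.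
rewrite EFinM -integral_sqr_std_normal_damped ?mulr_gt0//.
rewrite -ge0_integralZl//.
- by apply: eq_integral => z _; rewrite -EFinM /g /std_normal_damped; congr EFin; ring.
- apply/measurable_EFinP/measurable_funTS; apply: measurable_funM.
    by apply: measurable_funM.
  apply: measurable_funM; first exact: measurable_std_normal_pdf.
  apply: measurableT_comp => //; apply: measurableT_comp => //.
  apply: measurable_funM => //.
  apply: (measurableT_comp (@measurable_invr R)).
  by apply: measurable_funM.
- by move=> z _; rewrite lee_fin mulr_ge0 ?std_normal_damped_ge0// mulr_ge0 ?sqr_ge0.
- by rewrite lee_fin invr_ge0 ltW.
Qed.

(** * Gaussian tails *)

Lemma is_derive_std_normal_pdf (R : realType) (z : R) :
  is_derive z 1 (@std_normal_pdf R) (- (z * std_normal_pdf z)).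
Proof.
have dX : is_derive z 1 (fun z : R => z ^+ 2) (2 * z).
  by apply: is_derive_eq; rewrite /GRing.scale/=; ring.
have de := @is_derive1_comp R expR (fun w => - 2^-1 *: w ^+ 2) z _ _
  (is_derive_expR (- 2^-1 *: z ^+ 2)) (is_deriveZ (- 2^-1) dX).
have dd := is_deriveZ ((Num.sqrt (2 * pi))^-1) de.
have E : @std_normal_pdf R = (fun w => (Num.sqrt (2 * pi))^-1 *: expR (- 2^-1 *: w ^+ 2)).
  by apply/funext => w; rewrite /std_normal_pdf /GRing.scale/= mulNr (mulrC 2^-1).
rewrite {1}E; apply: (is_derive_eq dd).
rewrite /std_normal_pdf /GRing.scale/= /GRing.scale/= !mulNr (mulrC 2^-1 (z ^+ 2)).
rewrite mulKf ?pnatr_eq0// !mulrN; congr (- _).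
by rewrite [LHS]mulrA [LHS]mulrC.
Qed.

Lemma cvg_std_normal_pdf_y (R : realType) :
  @std_normal_pdf R z @[z --> +oo] --> (0 : R).
Proof.
have [+ _] := cvg_id_std_normal_damped (0 : R) => H.
apply: (@squeeze_cvgr _ _ _ _ (cst 0) (fun z => z * std_normal_damped 0 z)) => //; last exact: cvg_cst.
near=> z; have z1 : 1 <= z by near: z; exact: nbhs_pinfty_ge (num_real _).
rewrite (ltW (std_normal_pdf_gt0 z))/= /std_normal_damped expr0n/= mul0r oppr0 expR0 mulr1.
by rewrite ler_peMl// ltW// std_normal_pdf_gt0.
Unshelve. all: by end_near. Qed.

Lemma integral_oy_cy (R : realType) (u : R) (f : R -> R) :
  measurable_fun setT f ->
  (\int[lebesgue_measure]_(z in `]u%R, +oo[) (f z)%:E =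
   \int[lebesgue_measure]_(z in `[u%R, +oo[) (f z)%:E)%E.
Proof.
move=> mf; apply: integral_itv_obnd_cbnd.
exact/measurable_EFinP/measurable_funTS.
Qed.

(** The upper Mills bound: [z / u >= 1] on [z >= u], and [z] times the normal
    density is the derivative of minus the density. *)
Lemma gaussian_tail_le (R : realType) (u : R) : 0 < u ->
  (\int[lebesgue_measure]_(z in `[u%R, +oo[) (2 * std_normal_pdf z)%:E <=
   (2 * std_normal_pdf u / u)%:E)%E.
Proof.
move=> u0.
have mphi := @measurable_std_normal_pdf R.
have <- : (\int[lebesgue_measure]_(z in `]u%R, +oo[)
    (2 / u * (z * std_normal_pdf z))%:E = (2 * std_normal_pdf u / u)%:E)%E.
  pose F z := - (2 / u) *: std_normal_pdf z.
  rewrite (_ : 2 * _ / u = - (2 / u) *: 0 - F u); last first.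
    by rewrite /F /GRing.scale/= mulr0; field; rewrite gt_eqF.
  apply: (@ge0_FTC_oy R (fun z => 2 / u * (z * std_normal_pdf z)) F u _ _).
  - move=> z uz; rewrite mulr_ge0 ?divr_ge0 ?(ltW u0)//.
    by rewrite mulr_ge0 ?(ltW (lt_trans u0 uz)) ?(ltW (std_normal_pdf_gt0 _)).
  - move=> z uz; apply: continuousM; first exact: cst_continuous.
    by apply: continuousM; [exact: cvg_id|exact: continuous_std_normal_pdf].
  - move=> z uz.
    have dd := is_deriveZ (- (2 / u)) (is_derive_std_normal_pdf z).
    have {dd}d : is_derive z 1 F _ := dd.
    by apply: (is_derive_eq d); rewrite /GRing.scale/=; ring.
  - apply: cvg_at_right_filter; apply: cvgZl_tmp; exact: continuous_std_normal_pdf.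
  - by apply: cvgZl_tmp; exact: cvg_std_normal_pdf_y.
rewrite integral_oy_cy; last first.
  by apply: measurable_funM => //; apply: measurable_funM.
apply: ge0_le_integral => //.
- by move=> z _; rewrite lee_fin mulr_ge0// ltW// std_normal_pdf_gt0.
- by apply/measurable_EFinP/measurable_funTS; apply: measurable_funM.
- apply/measurable_EFinP/measurable_funTS; apply: measurable_funM => //.
  exact: measurable_funM.
- move=> z /=; rewrite in_itv/= andbT lee_fin => uz.
  rewrite -mulrA ler_wpM2l// mulrA ler_peMl ?(ltW (std_normal_pdf_gt0 _))//.
  by rewrite mulrC ler_pdivlMr// mul1r.
Qed.

(** The lower Mills bound: the derivative of minus [pdf z / z] is
    [pdf z * (1 + z^-2)], and [z^-2 <= u^-2] on [z >= u]. *)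
Lemma gaussian_tail_ge (R : realType) (u : R) : 0 < u ->
  ((2 * std_normal_pdf u / u / (1 + u ^- 2))%:E <=
   \int[lebesgue_measure]_(z in `[u%R, +oo[) (2 * std_normal_pdf z)%:E)%E.
Proof.
move=> u0.
have mphi := @measurable_std_normal_pdf R.
have u20 : 0 < 1 + u ^- 2 by rewrite ltr_pwDl// invr_ge0 sqr_ge0.
(* the constant for which c (1 + z^-2) <= 2 on z >= u *)
pose c := 2 / (1 + u ^- 2).
have mf : measurable_fun setT (fun z : R => c * (std_normal_pdf z * (1 + (z ^+ 2)^-1))).
  apply: measurable_funM => //; apply: measurable_funM => //.
  apply: measurable_funD => //.
  exact: (measurableT_comp (@measurable_invr R) (@exprn_measurable R setT 2)).
have c0 : 0 <= c by rewrite divr_ge0// ltW.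
have <- : (\int[lebesgue_measure]_(z in `]u%R, +oo[)
    (c * (std_normal_pdf z * (1 + (z ^+ 2)^-1)))%:E =
    (2 * std_normal_pdf u / u / (1 + u ^- 2))%:E)%E.
  pose F z := - c *: (std_normal_pdf z * z^-1).
  rewrite (_ : 2 * _ / u / _ = - c *: 0 - F u); last first.
    by rewrite /F /c /GRing.scale/= mulr0; ring.
  apply: (@ge0_FTC_oy R
    (fun z => c * (std_normal_pdf z * (1 + (z ^+ 2)^-1))) F u _ _).
  - move=> z uz; rewrite mulr_ge0// mulr_ge0 ?(ltW (std_normal_pdf_gt0 _))//.
    by rewrite addr_ge0// invr_ge0 sqr_ge0.
  - move=> z uz; have z0 : 0 < z by exact: lt_trans uz.
    apply: continuousM; first exact: cst_continuous.
    apply: continuousM; first exact: continuous_std_normal_pdf.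
    apply: continuousD; first exact: cst_continuous.
    apply: continuousV; first by rewrite expf_neq0// gt_eqF.
    exact: exprn_continuous.
  - move=> z uz; have z0 : 0 < z by exact: lt_trans uz.
    have zn0 : z != 0 by rewrite gt_eqF.
    have dV : is_derive z 1 (fun z : R => z^-1) (- z ^- 2 *: 1).
      exact: (@is_deriveV R id z 1 1 zn0 (@is_derive_id R R z 1)).
    have dd := is_deriveZ (- c) (is_deriveM (is_derive_std_normal_pdf z) dV).
    have {dd}d : is_derive z 1 F _ := dd.
    by apply: (is_derive_eq d); rewrite /GRing.scale/=; field.
  - apply: cvg_at_right_filter; apply: cvgZl_tmp; apply: cvgM.
      exact: continuous_std_normal_pdf.
    by apply: inv_continuous; rewrite gt_eqF.
  - apply: cvgZl_tmp; rewrite -[X in _ --> X](mulr0 (0 : R)); apply: cvgM.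
      exact: cvg_std_normal_pdf_y.
    apply/gtr0_cvgV0; last exact: cvg_id.
    near=> z; near: z; exact: nbhs_pinfty_gt (num_real _).
rewrite integral_oy_cy//; apply: ge0_le_integral => //.
- move=> z _; rewrite lee_fin mulr_ge0// mulr_ge0 ?(ltW (std_normal_pdf_gt0 _))//.
  by rewrite addr_ge0// invr_ge0 sqr_ge0.
- by apply/measurable_EFinP/measurable_funTS.
- by apply/measurable_EFinP/measurable_funTS; apply: measurable_funM.
- move=> z /=; rewrite in_itv/= andbT lee_fin => uz.
  rewrite mulrCA mulrC ler_wpM2r ?(ltW (std_normal_pdf_gt0 _))//.
  rewrite /c mulrAC ler_pdivrMr// ler_wpM2l// lerD2l lef_pV2 ?posrE ?exprn_gt0//.
    by rewrite ler_sqr ?nnegrE ?(ltW u0) ?(le_trans (ltW u0)).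
  exact: lt_le_trans uz.
Unshelve. all: by end_near. Qed.

(** * Gaussian integrals and independence of the past *)

Lemma complete_square (R : realType) (h c w z : R) : 0 < h -> 0 <= c ->
  - (c / 2 * (w + z) ^+ 2) + - z ^+ 2 / (h *+ 2) =
  - (c / (1 + c * h) / 2 * w ^+ 2) +
  - (z + c * w * (h / (1 + c * h))) ^+ 2 / (h / (1 + c * h) *+ 2).
Proof.
move=> h0 c0.
have d0 : 0 < 1 + c * h by rewrite ltr_pwDl// mulr_ge0// ltW.
by field; rewrite !gt_eqF.
Qed.

(** Completing the square turns the integrand into a multiple of a normal density
    of variance [h / (1 + c h)]. *)
Lemma integral_normal_expR_sqr (R : realType) (h c w : R) : 0 < h -> 0 <= c ->
  (\int[normal_prob 0 (Num.sqrt h)]_z (expR (- (c / 2 * (w + z) ^+ 2)))%:E =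
   ((Num.sqrt (1 + c * h))^-1 * expR (- (c / (1 + c * h) / 2 * w ^+ 2)))%:E)%E.
Proof.
move=> h0 c0.
pose s := Num.sqrt h.
have s0 : 0 < s by rewrite sqrtr_gt0.
have sn0 : s != 0 by rewrite gt_eqF.
have d0 : 0 < 1 + c * h by rewrite ltr_pwDl// mulr_ge0// ltW.
pose h' := h / (1 + c * h).
have h'0 : 0 < h' by rewrite divr_gt0.
pose s' := Num.sqrt h'.
have s'0 : s' != 0 by rewrite gt_eqF// sqrtr_gt0.
rewrite (@integral_density R _ (measurableTypeR R) lebesgue_measure _ (normal_pdf 0 s)); last 5 first.
- exact: measurable_normal_pdf.
- by move=> z; exact: normal_pdf_ge0.
- by [].
- apply/measurable_EFinP; apply: measurableT_comp => //; apply: measurableT_comp => //.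
  apply: measurable_funM => //; apply: measurable_funX => //.
  exact: measurable_funD.
- by move=> z; rewrite lee_fin expR_ge0.
transitivity (\int[lebesgue_measure]_z
  (((Num.sqrt (1 + c * h))^-1 * expR (- (c / (1 + c * h) / 2 * w ^+ 2)))%:E *
   (normal_pdf (- (c * w * h')) s' z)%:E))%E.
  apply: eq_integral => z _; rewrite -!EFinM; congr EFin.
  rewrite !normal_pdfE// /normal_peak /normal_fun subr0.
  rewrite /s /s' !sqr_sqrtr ?(ltW h0) ?(ltW h'0)//.
  have -> : Num.sqrt (h * pi *+ 2) = Num.sqrt (1 + c * h) * Num.sqrt (h' * pi *+ 2).
    rewrite -sqrtrM ?(ltW d0)//; congr Num.sqrt.
    by rewrite /h' -mulrnAr; field; rewrite gt_eqF.
  rewrite invfM opprK.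
  set p := (Num.sqrt (1 + c * h))^-1; set q := (Num.sqrt (h' * pi *+ 2))^-1.
  set A := - (c / 2 * _); set B := - z ^+ 2 / _; set C := - (c / _ / 2 * _).
  set D := - (_ + _) ^+ 2 / _.
  have -> : expR A * (p * q * expR B) = p * q * expR (A + B) by rewrite expRD; ring.
  have -> : p * expR C * (q * expR D) = p * q * expR (C + D) by rewrite expRD; ring.
  by congr (_ * expR _); exact: complete_square.
rewrite ge0_integralZl//; last 2 first.
- by apply/measurable_EFinP; exact: measurable_normal_pdf.
- by move=> z _; rewrite lee_fin normal_pdf_ge0.
by rewrite integral_normal_pdf mule1.
Qed.

(** The freezing lemma: when [X] is independent of [Y] with law [N], the law of
    the pair is a product measure, and [Y] can be held fixed while integrating
    over [X]. *)
Lemma integral_freezing (R : realType) (d d' d2 : measure_display)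
    (Omega : measurableType d) (P : probability Omega R)
    (T : measurableType d') (U : measurableType d2)
    (N : {sigma_finite_measure set U -> \bar R})
    (Y : Omega -> T) (X : Omega -> U) (F : T * U -> \bar R) :
  measurable_fun setT Y -> measurable_fun setT X ->
  (forall A B, measurable A -> measurable B ->
    P (Y @^-1` A `&` X @^-1` B) = (P (Y @^-1` A) * N B)%E) ->
  measurable_fun setT F -> (forall p, 0 <= F p)%E ->
  (\int[P]_w F (Y w, X w) = \int[P]_w \int[N]_z F (Y w, z))%E.
Proof.
move=> mY mX indep mF F0.
have mYX : measurable_fun setT (fun w => (Y w, X w)) by exact: measurable_fun_pair.
have [m mE mI] := exists_pushforward P mYX.
(* the joint law m of (Y, X) is the product of the law q0 of Y with N *)
have [q0 qE0 qI0] := exists_pushforward P mY.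
have sfq : sigma_finite setT q0.
  exists (fun=> setT); first by rewrite bigcup_const.
  move=> _; split=> //; rewrite qE0// preimage_setT.
  exact: (le_lt_trans (probability_le1 P measurableT) (ltry _)).
have [q qE] := exists_sigma_finite sfq.
rewrite -mI//.
have E : (\int[m]_p F p = \int[q \x N]_p F p)%E.
  apply: eq_measure_integral => A mA _; apply/esym.
  apply: product_measure_unique => // A1 B1 mA1 mB1.
  rewrite mE; last exact: measurableX.
  rewrite qE qE0// -indep//; congr (P _); apply/seteqP; split => w //.
rewrite E fubini_tonelli1//= /fubini_F.
rewrite (eq_measure_integral q0) => [|A _ _]; last exact: qE.
by rewrite qI0//; [exact: measurable_fun_fubini_tonelli_F|move=> t; exact: integral_ge0].
Qed.

Definition past_cylinders (R : realType) (Omega : Type) (X : nat -> Omega -> R)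
    (n : nat) : set (set Omega) :=
  [set C | exists2 B : nat -> set R, (forall i, measurable (B i)) &
     C = [set w | forall i, (i < n)%N -> B i (X i w)]].

Lemma past_cylinders_setI (R : realType) (Omega : Type)
    (X : nat -> Omega -> R) n : setI_closed (past_cylinders X n).
Proof.
move=> _ _ [B mB ->] [B' mB' ->]; exists (fun i => B i `&` B' i).
  by move=> i; exact: measurableI.
apply/seteqP; split => w /=.
- by move=> [H H'] i ni; split; [exact: H|exact: H'].
- by move=> H; split => i ni; have [] := H i ni.
Qed.

Lemma past_cylinders_setT (R : realType) (Omega : Type)
    (X : nat -> Omega -> R) n : past_cylinders X n setT.
Proof.
by exists (fun=> setT) => //; apply/seteqP; split.
Qed.

Lemma past_cylinders_measurable (R : realType) (d : measure_display)
    (Omega : measurableType d) (X : nat -> Omega -> R) n :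
  (forall i, measurable_fun setT (X i)) ->
  past_cylinders X n `<=` measurable.
Proof.
move=> mX _ [B mB ->].
have -> : [set w | forall i, (i < n)%N -> B i (X i w)] =
    \bigcap_(i in `I_n) (X i @^-1` B i) by [].
apply: bigcap_measurableType => i _.
rewrite -[X in measurable X]setTI; exact: mX.
Qed.

(** The mutual independence of [X 0, ..., X n] gives the product rule for
    cylinders.  Both sides are finite measures in [C], the cylinders are stable
    under intersection, hence the rule extends to the generated sigma-algebra. *)
Lemma past_independent (R : realType) (d : measure_display)
    (Omega : measurableType d) (P : probability Omega R)
    (X : nat -> Omega -> R) n :
  (forall i, measurable_fun setT (X i)) ->
  independent_RVs P (fun i : 'I_n.+1 => X i) ->
  forall C B, <<s past_cylinders X n >> C -> measurable B ->
  P (C `&` X n @^-1` B) = (P C * P (X n @^-1` B))%E.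
Proof.
move=> mX ind C B sC mB.
have mXB : measurable (X n @^-1` B) by rewrite -[X in measurable X]setTI; exact: mX.
have indE (B' : nat -> set R) : (forall i, measurable (B' i)) ->
    P [set w | forall i, (i < n.+1)%N -> B' i (X i w)] =
    (\prod_(i < n.+1) P (X i @^-1` B' i))%E.
  move=> mB'; rewrite -(ind (fun i => B' i))//; congr (P _).
  apply/seteqP; split=> w /= H i; first exact: H.
  by move=> ni; exact: (H (Ordinal ni)).
have PfinB : P (X n @^-1` B) \is a fin_num by exact: fin_num_measure.
pose c := fine (P (X n @^-1` B)).
have c0 : 0 <= c by exact: fine_ge0.
have -> : (P C * P (X n @^-1` B))%E = mscale (NngNum c0) P C.
  by rewrite /mscale/= muleC fineK.
rewrite -[LHS]/(mrestr P mXB C).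
apply: (@g_sigma_algebra_measure_unique _ _ _ (past_cylinders X n) _ (fun=> setT)) sC.
- exact: past_cylinders_measurable.
- by move=> _; exact: past_cylinders_setT.
- by rewrite bigcup_const.
- exact: past_cylinders_setI.
- move=> _ [B' mB' ->].
  (* the product rule, applied with B and with setT at the last place *)
  pose B1 i := if i == n then B else B' i.
  pose B2 i := if i == n then setT else B' i.
  have mB1 i : measurable (B1 i) by rewrite /B1; case: ifP.
  have mB2 i : measurable (B2 i) by rewrite /B2; case: ifP.
  set A := [set w | _].
  have A1 : [set w | forall i, (i < n.+1)%N -> B1 i (X i w)] = A `&` X n @^-1` B.
    apply/seteqP; split => w /=.
      move=> H; split; last by have := H n (ltnSn n); rewrite /B1 eqxx.
      by move=> i ni; have := H i (ltnW ni); rewrite /B1 ltn_eqF.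
    move=> [HA HB] i; rewrite ltnS leq_eqVlt /B1.
    by case: eqVneq => [->//|_ /=]; exact: HA.
  have A2 : [set w | forall i, (i < n.+1)%N -> B2 i (X i w)] = A.
    apply/seteqP; split => w /=.
      by move=> H i ni; have := H i (ltnW ni); rewrite /B2 ltn_eqF.
    move=> HA i; rewrite ltnS leq_eqVlt /B2.
    by case: eqVneq => [->//|_ /=]; exact: HA.
  have E12 : (\prod_(i < n) P (X i @^-1` B1 i) =
              \prod_(i < n) P (X i @^-1` B2 i))%E.
    by apply: eq_bigr => i _; rewrite /B1 /B2 ltn_eqF.
  have := indE B2 mB2; rewrite A2 big_ord_recr/= {2}/B2 eqxx preimage_setT.
  rewrite probability_setT mule1 => PA.
  have := indE B1 mB1; rewrite A1 big_ord_recr/= {2}/B1 eqxx E12 -PA => PAB.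
  by rewrite /mrestr/= /mscale/= PAB fineK// muleC.
- move=> _; rewrite /= /mrestr setTI; exact: (le_lt_trans (probability_le1 P mXB) (ltry _)).
Qed.

(** * The Laplace transform of the squares of a Gaussian random walk *)

Definition walk (R : realType) (Omega : Type) (x : R) (X : nat -> Omega -> R)
    (k : nat) (w : Omega) : R := x + \sum_(i < k) X i w.

Definition walk_sq_sum (R : realType) (Omega : Type) (x : R)
    (X : nat -> Omega -> R) (k : nat) (w : Omega) : R :=
  \sum_(i < k) walk x X i w ^+ 2.

Lemma measurable_walk (R : realType) (d : measure_display)
    (Omega : measurableType d) (x : R) (X : nat -> Omega -> R) (k : nat) :
  (forall i, (i < k)%N -> measurable_fun setT (X i)) ->
  measurable_fun setT (walk x X k).
Proof.
move=> mX; apply: measurable_funD => //.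
by apply: measurable_sum => i; exact: mX.
Qed.

Lemma measurable_walk_sq_sum (R : realType) (d : measure_display)
    (Omega : measurableType d) (x : R) (X : nat -> Omega -> R) (k : nat) :
  (forall i, (i < k)%N -> measurable_fun setT (X i)) ->
  measurable_fun setT (walk_sq_sum x X k).
Proof.
move=> mX; apply: measurable_sum => i; apply: measurable_funX.
by apply: measurable_walk => j ji; apply: mX; exact: ltn_trans ji _.
Qed.

Lemma measurable_past (R : realType) (d : measure_display)
    (Omega : measurableType d) (X : nat -> Omega -> R) (k i : nat) : (i < k)%N ->
  measurable_fun setT (X i : g_sigma_algebraType (past_cylinders X k) -> R).
Proof.
move=> ik _ B mB; rewrite setTI; apply: sub_sigma_algebra.
exists (fun j => if j == i then B else setT); first by move=> j; case: ifP.
apply/seteqP; split=> w /=.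
  by move=> H j _; case: eqVneq => // ->.
by move=> /(_ i ik); rewrite eqxx.
Qed.

(** Integrating out the last increment replaces the quadratic coefficient [c] of
    the endpoint by [c / (1 + c h)], to which the last term of the sum of squares
    adds [kappa]. *)
Lemma walk_step (R : realType) (d : measure_display)
    (Omega : measurableType d) (P : probability Omega R) (x h kappa c : R)
    (X : nat -> Omega -> R) (k : nat) : 0 < h -> 0 <= kappa -> 0 <= c ->
  (forall i, measurable_fun setT (X i)) ->
  (forall n, independent_RVs P (fun i : 'I_n => X i)) ->
  (forall i B, measurable B ->
     P (X i @^-1` B) = normal_prob 0 (Num.sqrt h) B) ->
  (\int[P]_w (expR (- (kappa / 2 * walk_sq_sum x X k.+1 w) -
                    c / 2 * walk x X k.+1 w ^+ 2))%:E =
   (Num.sqrt (1 + c * h))^-1%:E *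
   \int[P]_w (expR (- (kappa / 2 * walk_sq_sum x X k w) -
                    (kappa + c / (1 + c * h)) / 2 * walk x X k w ^+ 2))%:E)%E.
Proof.
move=> h0 kappa0 c0 mX indX lawX.
pose Y w := (walk x X k w, walk_sq_sum x X k w).
pose F (p : (R * R) * R) : \bar R :=
  (expR (- (kappa / 2 * (p.1.2 + p.1.1 ^+ 2)) - c / 2 * (p.1.1 + p.2) ^+ 2))%:E.
have mY : measurable_fun setT Y.
  by apply: measurable_fun_pair; [exact: measurable_walk|exact: measurable_walk_sq_sum].
have mYpast : measurable_fun setT
    (Y : g_sigma_algebraType (past_cylinders X k) -> R * R).
  apply: measurable_fun_pair.
    by apply: measurable_walk => i ik; exact: measurable_past.
  by apply: measurable_walk_sq_sum => i ik; exact: measurable_past.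
have mF : measurable_fun setT F.
  apply/measurable_EFinP; apply: measurableT_comp => //.
  have m11 : measurable_fun setT (fun p : (R * R) * R => p.1.1).
    exact: measurableT_comp.
  have m12 : measurable_fun setT (fun p : (R * R) * R => p.1.2).
    exact: measurableT_comp.
  apply: measurable_funB.
    apply: measurableT_comp => //; apply: measurable_funM => //.
    by apply: measurable_funD => //; exact: measurable_funX.
  apply: measurable_funM => //; apply: measurable_funX.
  exact: measurable_funD.
have F0 p : (0 <= F p)%E by rewrite lee_fin expR_ge0.
transitivity (\int[P]_w F (Y w, X k w))%E.
  apply: eq_integral => w _; rewrite /F/= /walk_sq_sum big_ord_recr/=.
  by rewrite /walk big_ord_recr/= addrA.
rewrite (@integral_freezing _ _ _ _ _ P _ _ (normal_prob 0 (Num.sqrt h)) Y (X k) F)//; last 2 first.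
- exact: mX.
- move=> A B mA mB.
  have sA : <<s past_cylinders X k >> (Y @^-1` A).
    by have := mYpast measurableT A mA; rewrite setTI.
  apply: (eq_trans (past_independent mX (indX _) sA mB)).
  by congr (_ * _)%E; exact: lawX.
rewrite -ge0_integralZl//; last first.
- apply/measurable_EFinP; apply: measurableT_comp => //; apply: measurable_funB.
    apply: measurableT_comp => //; apply: measurable_funM => //.
    exact: measurable_walk_sq_sum.
  by apply: measurable_funM => //; apply: measurable_funX; exact: measurable_walk.
apply: eq_integral => w _; rewrite /F /=.
under eq_integral => z _ do rewrite expRD EFinM.
rewrite ge0_integralZl//; last first.
- apply/measurable_EFinP; apply: measurableT_comp => //; apply: measurableT_comp => //.
  by apply: measurable_funM => //; apply: measurable_funX; exact: measurable_funD.
rewrite integral_normal_expR_sqr// -!EFinM; congr EFin.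
rewrite mulrCA; congr (_ * _); rewrite -expRD; congr expR.
by field; rewrite gt_eqF// ltr_pwDl// mulr_ge0// ltW.
Qed.

(** The Riccati recursion [c |-> kappa + c / (1 + c h)] in projective coordinates
    [c = u / v], where it is linear: [v' = v + h u] and [u' = u + kappa v'].  The
    product of the factors [1 + c h] telescopes to a ratio of values of [v]. *)
Definition riccati_step (R : realType) (h kappa : R) (p : R * R) : R * R :=
  let v := p.2 + h * p.1 in (p.1 + kappa * v, v).

Lemma riccati_step_ge (R : realType) (h kappa : R) (p : R * R) n :
  0 <= h -> 0 <= kappa -> 0 <= p.1 -> 0 < p.2 ->
  0 <= (iter n (riccati_step h kappa) p).1 /\
  0 < (iter n (riccati_step h kappa) p).2.
Proof.
move=> h0 k0 p1 p2; elim: n => [//|n [IH1 IH2]]; rewrite iterS /riccati_step/=.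
have : 0 <= h * (iter n (riccati_step h kappa) p).1 by rewrite mulr_ge0.
split; last by lra.
by rewrite addr_ge0// mulr_ge0// addr_ge0// ltW.
Qed.

Lemma walk_laplace (R : realType) (d : measure_display)
    (Omega : measurableType d) (P : probability Omega R) (x h kappa : R)
    (X : nat -> Omega -> R) (k : nat) (p : R * R) :
  0 < h -> 0 <= kappa -> 0 <= p.1 -> 0 < p.2 ->
  (forall i, measurable_fun setT (X i)) ->
  (forall n, independent_RVs P (fun i : 'I_n => X i)) ->
  (forall i B, measurable B ->
     P (X i @^-1` B) = normal_prob 0 (Num.sqrt h) B) ->
  let q := iter k (riccati_step h kappa) p in
  (\int[P]_w (expR (- (kappa / 2 * walk_sq_sum x X k w) -
                    p.1 / p.2 / 2 * walk x X k w ^+ 2))%:E =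
   (Num.sqrt (p.2 / q.2) * expR (- (q.1 / q.2 / 2 * x ^+ 2)))%:E)%E.
Proof.
move=> h0 k0 + + mX indX lawX /=.
elim: k p => [|k IH] p p1 p2.
  rewrite /= divff ?gt_eqF// sqrtr1 mul1r.
  under eq_integral => w _ do
    rewrite /walk_sq_sum /walk !big_ord0 mulr0 oppr0 add0r addr0.
  by rewrite integral_cst//= probability_setT mule1.
pose p' := riccati_step h kappa p.
have [p'1 p'2] : 0 <= p'.1 /\ 0 < p'.2.
  exact: (@riccati_step_ge _ h kappa p 1 (ltW h0) k0 p1 p2).
rewrite (@walk_step _ _ _ _ x h kappa _ X k h0 k0 (divr_ge0 p1 (ltW p2)) mX indX lawX).
have p'2E : p'.2 = p.2 + h * p.1 by [].
have -> : kappa + p.1 / p.2 / (1 + p.1 / p.2 * h) = p'.1 / p'.2.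
  rewrite /p' /riccati_step/=; field.
  by rewrite -p'2E !gt_eqF//.
rewrite IH// iterSr -EFinM mulrA; congr (_ * _)%:E.
have [_ q2] := @riccati_step_ge _ h kappa p' k (ltW h0) k0 p'1 p'2.
rewrite -[iter k _ _]/(iter k (riccati_step h kappa) p').
rewrite -sqrtrV; last by rewrite addr_ge0// mulr_ge0 ?divr_ge0 ?(ltW p2) ?(ltW h0).
rewrite -sqrtrM; last by rewrite invr_ge0 addr_ge0// mulr_ge0 ?divr_ge0 ?(ltW p2) ?(ltW h0).
congr Num.sqrt; have : p.2 + h * p.1 != 0 by rewrite -p'2E gt_eqF.
move: q2; rewrite p'2E; set r := (iter _ _ _).2 => r0 H; field.
apply/and3P; split; [by rewrite gt_eqF|by rewrite gt_eqF|].
by rewrite mulrC in H; exact: H.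
Qed.

(** * The limit of the Riccati recursion *)

(** With [p = u / l] and [th = l h], one step maps [v] to [v + th p] and [p] to
    [p + th (v + th p)], a discretization of the hyperbolic rotation
    [v = cosh], [p = sinh].  The quadratic form [v^2 - p^2 + th p v] is exactly
    preserved, and [v + p] is multiplied by [exp (th + O (th^2))]. *)
Lemma riccati_bounds (R : realType) (h l : R) n :
  0 < h -> 0 < l -> l * h <= 1 ->
  let q := iter n (riccati_step h (l ^+ 2 * h)) (0, 1) in
  [/\ q.2 ^+ 2 - (q.1 / l) ^+ 2 + l * h * (q.1 / l) * q.2 = 1,
      expR (n%:R * (l * h - (l * h) ^+ 2)) <= q.2 + q.1 / l &
      q.2 + q.1 / l <= expR (n%:R * (l * h + (l * h) ^+ 2))].
Proof.
move=> h0 l0 lh1 /=; set th := l * h in lh1 *.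
have th0 : 0 < th by rewrite mulr_gt0.
elim: n => [|n [IH1 IH2 IH3]] /=.
  by rewrite !mul0r expr0n/= mulr0 mul0r !addr0 expr1n subr0 expR0; split.
have [u0 v0] := @riccati_step_ge R h (l ^+ 2 * h) (0, 1) n (ltW h0)
  (mulr_ge0 (sqr_ge0 l) (ltW h0)) (lexx _) ltr01.
move: IH1 IH2 IH3 u0 v0; set q := iter n _ _; move: (q) => [u v] /=.
set p := u / l => IH1 IH2 IH3 u0 v0.
have p0 : 0 <= p by rewrite divr_ge0// ltW.
have uE : u = l * p by rewrite /p mulrC divfK// gt_eqF.
have hu : h * u = th * p by rewrite uE /th; ring.
have pE : (u + l ^+ 2 * h * (v + h * u)) / l = p + th * (v + th * p).
  by rewrite hu /p /th; field; rewrite gt_eqF.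
rewrite pE hu -[n.+1%:R]natr1 !mulrDl !mul1r.
have s0 : 0 <= v + p by rewrite addr_ge0// ltW.
have thp : 0 <= th ^+ 2 * p by rewrite mulr_ge0// sqr_ge0.
have thv : 0 <= th ^+ 2 * v by rewrite mulr_ge0// ?sqr_ge0 ?ltW.
split.
- by rewrite -IH1; ring.
- rewrite expRD.
  apply: (@le_trans _ _ ((v + p) * (1 + th))); last by nra.
  apply: ler_pM; rewrite ?expR_ge0//.
  have s1 : 0 < 1 - (th - th ^+ 2) by nra.
  have : expR (- (th - th ^+ 2)) >= 1 - (th - th ^+ 2).
    by apply: le_trans (expR_ge1Dx _).
  rewrite expRN => H.
  rewrite -[leLHS]invrK; apply: (@le_trans _ _ (1 - (th - th ^+ 2))^-1).
    by rewrite lef_pV2 ?posrE ?invr_gt0 ?expR_gt0.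
  rewrite -[leLHS]mul1r ler_pdivrMr//.
  have : 0 <= th ^+ 3 by rewrite exprn_ge0// ltW.
  have -> : (1 + th) * (1 - (th - th ^+ 2)) = 1 + th ^+ 3 by ring.
  lra.
- rewrite expRD.
  apply: (@le_trans _ _ ((v + p) * (1 + (th + th ^+ 2)))); first by nra.
  by apply: ler_pM; rewrite ?expR_ge1Dx// addr_ge0// addr_ge0 ?sqr_ge0// ltW.
Qed.

(** The bounds give the limit [exp (l T)] of [v + p]; the limit [exp (- l T)] of
    [v - p] then follows from the conserved quadratic form, whose cross term
    vanishes in the limit. *)
Lemma cvg_riccati (R : realType) (T l : R) : 0 < T -> 0 < l ->
  let q n := iter n.+1 (riccati_step (T / n.+1%:R) (l ^+ 2 * (T / n.+1%:R))) (0, 1) in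
  (q n).2 @[n --> \oo] --> (expR (l * T) + expR (- (l * T))) / 2 /\
  (q n).1 @[n --> \oo] --> l * ((expR (l * T) - expR (- (l * T))) / 2).
Proof.
move=> T0 l0 q.
pose L := l * T; have L0 : 0 < L by rewrite mulr_gt0.
pose th n := l * (T / n.+1%:R).
have thE n : th n = L * n.+1%:R^-1 by rewrite /th mulrA.
have th_cvg : th n @[n --> \oo] --> (0 : R).
  have -> : th = (fun n => L * harmonic n) by apply/funext => n; exact: thE.
  by rewrite -[X in _ --> X](mulr0 L); apply: cvgM; [exact: cvg_cst|exact: cvg_harmonic].
have nth n : n.+1%:R * th n = L.
  by rewrite thE mulrCA divff ?mulr1// pnatr_eq0.
pose s n := (q n).2 + (q n).1 / l.
pose d n := (q n).2 - (q n).1 / l.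
have nearth : \forall n \near \oo, th n <= 1.
  by apply: (cvgr_le (0 : R)) => //.
have bnd : \forall n \near \oo,
  [/\ s n * d n = 1 - th n * ((q n).1 / l) * (q n).2,
   expR (L - L * th n) <= s n & s n <= expR (L + L * th n)].
  near=> n.
  have H : th n <= 1 by near: n.
  have h0 : 0 < T / n.+1%:R by rewrite divr_gt0.
  have [H1 H2 H3] := riccati_bounds n.+1 h0 l0 H.
  rewrite -/(th n) in H1 H2 H3; split.
  - rewrite /s /d -H1 -/(q n); ring.
  - by rewrite (_ : L - _ = n.+1%:R * (th n - th n ^+ 2)) // -(nth n); ring.
  - by rewrite (_ : L + _ = n.+1%:R * (th n + th n ^+ 2)) // -(nth n); ring.
have cL : L * th n @[n --> \oo] --> (0 : R).
  by rewrite -[X in _ --> X](mulr0 L); apply: cvgM => //; exact: cvg_cst.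
have sL : s n @[n --> \oo] --> expR L.
  apply: (@squeeze_cvgr _ _ _ _ (fun n => expR (L - L * th n)) (fun n => expR (L + L * th n))).
  - by apply: filterS bnd => n [_ -> ->].
  - apply: continuous_cvg; first exact: continuous_expR.
    by rewrite -[X in _ --> X]subr0; apply: cvgB => //; exact: cvg_cst.
  - apply: continuous_cvg; first exact: continuous_expR.
    by rewrite -[X in _ --> X]addr0; apply: cvgD => //; exact: cvg_cst.
have q0 n : 0 <= (q n).1 /\ 0 < (q n).2.
  apply: riccati_step_ge => //; first by rewrite divr_ge0// ltW.
  by rewrite mulr_ge0 ?sqr_ge0// divr_ge0// ltW.
have s0 n : 0 < s n.
  by have [q1 q2] := q0 n; rewrite /s ltr_wpDr// divr_ge0// ltW.
have tpv : th n * ((q n).1 / l) * (q n).2 @[n --> \oo] --> (0 : R).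
  apply: (@squeeze_cvgr _ _ _ _ (cst 0) (fun n => th n * (s n * s n))).
  - near=> n; have [q1 q2] := q0 n.
    have q1l : 0 <= (q n).1 / l by rewrite divr_ge0// ltW.
    have th0 : 0 <= th n by rewrite thE mulr_ge0 ?(ltW L0).
    apply/andP; split.
      by apply: mulr_ge0; [exact: mulr_ge0|exact: ltW].
    rewrite -mulrA; apply: ler_wpM2l => //.
    by apply: ler_pM; [by []|exact: ltW|rewrite /s lerDr ltW|rewrite /s lerDl].
  - exact: cvg_cst.
  - rewrite -[X in _ --> X](mul0r (expR L * expR L)).
    by apply: cvgM => //; apply: cvgM.
have dL : d n @[n --> \oo] --> expR (- L).
  have : (1 - th n * ((q n).1 / l) * (q n).2) * (s n)^-1 @[n --> \oo] --> (1 - 0) * (expR L)^-1.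
    apply: cvgM; first by apply: cvgB => //; exact: cvg_cst.
    by apply: cvgV => //; rewrite gt_eqF ?expR_gt0.
  rewrite subr0 mul1r -expRN; apply: cvg_trans; apply: near_eq_cvg.
  by apply: filterS bnd => n [<- _ _]; rewrite mulrAC divff ?mul1r// gt_eqF.
split.
- have -> : (fun n => (q n).2) = (fun n => (s n + d n) / 2).
    by apply/funext => n; rewrite /s /d; field; rewrite gt_eqF.
  by apply: cvgM; [exact: cvgD|exact: cvg_cst].
- have -> : (fun n => (q n).1) = (fun n => l * ((s n - d n) / 2)).
    by apply/funext => n; rewrite /s /d; field; rewrite gt_eqF.
  apply: cvgM; first exact: cvg_cst.
  by apply: cvgM; [exact: cvgB|exact: cvg_cst].
Unshelve. all: by end_near. Qed.

(** * Riemann sums of continuous paths *)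

Lemma compact_uniform_continuity (R : realType) (K : set R) (g : R -> R) (e : R) :
  compact K -> continuous g -> 0 < e ->
  \forall d \near (0 : R)^'+, forall s t, K s -> `|s - t| <= d ->
    `|g s - g t| <= e.
Proof.
move=> cK cg e0.
suff H : \forall d \near (0 : R)^'+, K `<=` (fun s => forall t, `|s - t| <= d ->
    `|g s - g t| <= e).
  by apply: filterS H => d Hd s t Ks; exact: Hd.
apply: (iffLR (compact_near_coveringP K)) => // x Kx.
have e20 : 0 < e / 2 by rewrite divr_gt0.
have /cvgrPdist_lt/(_ _ e20) := cg x.
move=> /nbhs_ballP[r /= r0 Hr].
have r20 : 0 < r / 2 by rewrite divr_gt0.
near=> x' d => /= t td.
have xx' : `|x - x'| < r / 2.
  by near: x'; apply/nbhs_ballP; exists (r / 2).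
have dr : d <= r / 2 by near: d; exact: nbhs_right_le.
have H1 : `|g x - g x'| < e / 2 by apply: Hr => /=; rewrite /ball/=; lra.
have H2 : `|g x - g t| < e / 2.
  apply: Hr => /=; rewrite /ball/=.
  have := ler_distD x' x t; lra.
have := ler_distD (g x) (g x') (g t); rewrite (distrC (g x') (g x)); lra.
Unshelve. all: by end_near. Qed.

(** Each increment of the primitive of [g] is, by the mean value theorem, the
    step length times a value of [g] at an intermediate point; uniform
    continuity on the compact interval compares it with the value at the left
    end. *)
Lemma riemann_sum_cvg (R : realType) (g : R -> R) (T : R) : 0 < T ->
  continuous g ->
  T / n.+1%:R * \sum_(i < n.+1) g (i%:R * (T / n.+1%:R)) @[n --> \oo] -->
  \int[lebesgue_measure]_(s in `[0, T]) g s.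
Proof.
move=> T0 cg.
pose F t := \int[lebesgue_measure]_(s in `[0, t]) g s.
have ig b : lebesgue_measure.-integrable `[0, b] (EFin \o g).
  apply: continuous_compact_integrable; first exact: segment_compact.
  exact: continuous_subspaceT.
have dF (t : R) : 0 < t -> is_derive t 1 F (g t).
  move=> t0.
  have tt1 : t < t + 1 by rewrite ltrDl.
  have [dF <-] := continuous_FTC1_closed tt1 (ig _) t0 (cg t).
  by rewrite derive1E; apply: DeriveDef.
have cF (b : R) : 0 <= b -> {within `[0, b], continuous F}.
  by move=> b0; exact: parameterized_integral_continuous b0 (ig b).
have F0 : F 0 = 0 by rewrite /F set_itv1 Rintegral_set1.
have incr (h : R) k : 0 < h -> exists2 c, k%:R * h < c < k.+1%:R * h &
    F (k.+1%:R * h) - F (k%:R * h) = h * g c.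
  move=> h0; have kk : k%:R * h < k.+1%:R * h by rewrite ltr_pM2r// ltr_nat.
  have k0 : 0 <= k%:R * h by rewrite mulr_ge0// ltW.
  have [t||c] := @MVT R F g (k%:R * h) (k.+1%:R * h) kk.
  - by rewrite in_itv/= => /andP[kt _]; apply: dF; exact: le_lt_trans kt.
  - apply: continuous_subspaceW (cF (k.+1%:R * h) _); last by rewrite (le_trans k0)// ltW.
    by move=> t/=; rewrite !in_itv/= => /andP[kt ->]; rewrite (le_trans k0 kt).
  - rewrite in_itv/= => kc ->; exists c => //.
    by rewrite -natr1 mulrDl mul1r addrAC subrr add0r mulrC.
apply/cvgrPdist_le => e e0.
have eT0 : 0 < e / T by rewrite divr_gt0.
have unif := @compact_uniform_continuity R `[0, T]%classic g _ (@segment_compact R 0 T) cg eT0.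
move: unif; rewrite near_withinE => /nbhs_ballP[del /= del0 Hdel].
have hcvg : (fun n => T * harmonic n) @ \oo --> (0 : R).
  by rewrite -[X in _ --> X](mulr0 T); apply: cvgM; [exact: cvg_cst|exact: cvg_harmonic].
near=> n.
have hd : T / n.+1%:R < del by near: n; exact: cvgr_lt hcvg _ del0.
pose h := T / n.+1%:R.
have h0 : 0 < h by rewrite divr_gt0.
have nh : n.+1%:R * h = T by rewrite /h mulrCA divff ?mulr1// pnatr_eq0.
have unif : forall s t, `[0, T]%classic s -> `|s - t| <= h -> `|g s - g t| <= e / T.
  by apply: Hdel => //; rewrite /ball/= sub0r normrN gtr0_norm.
have -> : \int[lebesgue_measure]_(s in `[0, T]) g s =
    \sum_(i < n.+1) (F (i.+1%:R * h) - F (i%:R * h)).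
  rewrite -(big_mkord xpredT (fun i => F (i.+1%:R * h) - F (i%:R * h))).
  by rewrite telescope_sumr// nh mul0r F0 subr0.
rewrite mulr_sumr -sumrB (le_trans (ler_norm_sum _ _ _))//.
apply: (@le_trans _ _ (\sum_(i < n.+1) h * (e / T))).
  apply: ler_sum => i _; have [c /andP[c1 c2] ->] := incr h i h0.
  rewrite -mulrBr normrM gtr0_norm// ler_wpM2l ?(ltW h0)// distrC.
  have i0 : 0 <= i%:R * h by rewrite mulr_ge0// ltW.
  apply: unif => /=.
    rewrite in_itv/=; apply/andP; split=> //; rewrite -[leRHS]nh ler_pM2r//.
    by rewrite ler_nat ltnW.
  rewrite distrC ger0_norm ?subr_ge0 ?(ltW c1)//.
  move: c2; rewrite -natr1 mulrDl mul1r => c2; rewrite lerBlDl; exact: ltW.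
rewrite sumr_const card_ord -mulr_natl mulrA nh mulrCA divff ?mulr1// gt_eqF//.
Unshelve. all: by end_near. Qed.

(** Extends a path continuously by a constant to the negative times, where
    nothing is known about it. *)
Lemma continuous_max0 (R : realType) (f : R -> R) :
  {within `[0, +oo[, continuous f} -> continuous (fun s : R => f (Num.max 0 s)).
Proof.
move=> /continuous_within_itvcyP[cf f0] s.
have [s0|s0|s0] := ltgtP s 0.
- apply: (@cvg_trans _ (nbhs (f 0))); last by rewrite max_l ?(ltW s0).
  apply: cvg_near_cst; near=> t; apply/eqP; rewrite max_l//.
  by near: t; exact: lt_le_nbhsl.
- rewrite /continuous_at max_r ?(ltW s0)//.
  have : f t @[t --> s] --> f s by apply: cf; rewrite in_itv/= andbT.
  apply: cvg_trans; apply: near_eq_cvg; near=> t; rewrite max_r//.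
  by near: t; exact: lt_le_nbhsr.
- rewrite s0 /continuous_at maxxx; apply/cvgrPdist_lt => e e0.
  move/cvgrPdist_lt : f0 => /(_ _ e0); rewrite near_withinE.
  apply: filterS => t Ht; have [t0|t0] := leP t 0.
    by rewrite subrr normr0.
  exact: Ht.
Unshelve. all: by end_near. Qed.

(** * The Cameron-Martin formula *)

Definition coshR (R : realType) (z : R) : R := (expR z + expR (- z)) / 2.
Definition tanhR (R : realType) (z : R) : R :=
  (expR z - expR (- z)) / (expR z + expR (- z)).

(** The Laplace transform of the integral of the square of a Brownian motion
    started at [x], at [l^2/2]. *)
Definition cameron_martin (R : realType) (x T l : R) : R :=
  (Num.sqrt (coshR (l * T)))^-1 * expR (- (x ^+ 2 * l / 2 * tanhR (l * T))).

Definition riemann_sum (R : realType) (Omega : Type) (W : R -> Omega -> R)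
    (T : R) (n : nat) (w : Omega) : R :=
  T / n.+1%:R * \sum_(i < n.+1) W (i%:R * (T / n.+1%:R)) w ^+ 2.

Lemma riemann_sum_sq_integral (R : realType) (d : measure_display)
    (Omega : measurableType d) (P : probability Omega R)
    (W : R -> Omega -> R) (x T : R) (w : Omega) :
  brownian_motion P W x -> 0 < T ->
  riemann_sum W T n w @[n --> \oo] --> sq_integral W T w.
Proof.
move=> bm T0.
pose g (s : R) := W (Num.max 0 s) w ^+ 2.
have cg : continuous g.
  move=> s; have c := @continuous_max0 R (fun t => W t w) (@bm_continuous _ _ _ _ _ _ bm w) s.
  rewrite /g; under eq_fun do rewrite expr2.
  exact: (cvgM c c).
have := riemann_sum_cvg T0 cg.
have -> : \int[lebesgue_measure]_(s in `[0, T]) g s = sq_integral W T w.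
  apply: eq_Rintegral => s; rewrite inE/= in_itv/= => /andP[s0 _].
  by rewrite /g max_r.
apply: cvg_trans; apply: near_eq_cvg; apply: nearW => n.
rewrite /riemann_sum; congr (_ * _); apply: eq_bigr => i _.
by rewrite /g max_r// mulr_ge0// divr_ge0// ltW.
Qed.

Lemma measurable_riemann_sum (R : realType) (d : measure_display)
    (Omega : measurableType d) (P : probability Omega R)
    (W : R -> Omega -> R) (x T : R) n :
  brownian_motion P W x -> 0 < T -> measurable_fun setT (riemann_sum W T n).
Proof.
move=> bm T0; apply: measurable_funM => //; apply: measurable_sum => i.
apply: measurable_funX; apply: (bm_measurable bm).
by rewrite mulr_ge0// divr_ge0// ltW.
Qed.

Lemma measurable_sq_integral (R : realType) (d : measure_display)
    (Omega : measurableType d) (P : probability Omega R)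
    (W : R -> Omega -> R) (x T : R) :
  brownian_motion P W x -> 0 < T -> measurable_fun setT (sq_integral W T).
Proof.
move=> bm T0; apply: (@measurable_fun_cvg _ _ _ setT (riemann_sum W T)).
  by move=> n; exact: (measurable_riemann_sum _ bm T0).
by move=> w _; exact: (riemann_sum_sq_integral (w := w) bm T0).
Qed.

(** The values of the path at the grid points form a Gaussian random walk, almost
    surely started at [x]. *)
Lemma expectation_riemann_sum (R : realType) (d : measure_display)
    (Omega : measurableType d) (P : probability Omega R)
    (W : R -> Omega -> R) (x T l : R) n :
  brownian_motion P W x -> 0 < T ->
  let q := iter n.+1 (riccati_step (T / n.+1%:R) (l ^+ 2 * (T / n.+1%:R))) (0, 1) in
  (\int[P]_w (expR (- (l ^+ 2 / 2 * riemann_sum W T n w)))%:E =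
   ((Num.sqrt q.2)^-1 * expR (- (q.1 / q.2 / 2 * x ^+ 2)))%:E)%E.
Proof.
move=> bm T0 q.
pose h := T / n.+1%:R.
have h0 : 0 < h by rewrite divr_gt0.
have ih0 (i : nat) : 0 <= i%:R * h by rewrite mulr_ge0// ltW.
pose X (i : nat) : Omega -> R := W (i.+1%:R * h) \- W (i%:R * h).
have mX i : measurable_fun setT (X i).
  by apply: measurable_funB; apply: (bm_measurable bm).
have indX m : independent_RVs P (fun i : 'I_m => X i).
  apply: (bm_independent bm (t := fun i => i%:R * h)); first by rewrite mul0r.
  by move=> i _; rewrite ler_pM2r// ler_nat.
have lawX i B : measurable B -> P (X i @^-1` B) = normal_prob 0 (Num.sqrt h) B.
  move=> mB; have lt : i%:R * h < i.+1%:R * h by rewrite ltr_pM2r// ltr_nat.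
  have := bm_gaussian bm (ih0 i) lt mB.
  have -> : i.+1%:R * h - i%:R * h = h by rewrite -natr1; ring.
  by move=> E; exact: E.
have wE w : W 0 w = x -> forall i, walk x X i w = W (i%:R * h) w.
  move=> W0 i; rewrite /walk /X/=.
  rewrite -(big_mkord xpredT (fun i => W (i.+1%:R * h) w - W (i%:R * h) w)).
  by rewrite telescope_sumr// mul0r W0 addrC subrK.
have k0 : 0 <= l ^+ 2 * h by rewrite mulr_ge0 ?sqr_ge0// ltW.
have H : (\int[P]_w (expR (- (l ^+ 2 * h / 2 * walk_sq_sum x X n.+1 w) -
      0 / 1 / 2 * walk x X n.+1 w ^+ 2))%:E =
    (Num.sqrt (1 / q.2) * expR (- (q.1 / q.2 / 2 * x ^+ 2)))%:E)%E.
  exact: (@walk_laplace _ _ _ P x h (l ^+ 2 * h) X n.+1 (0, 1)).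
have [_ q2] := @riccati_step_ge R h (l ^+ 2 * h) (0, 1) n.+1 (ltW h0) k0 (lexx 0) ltr01.
rewrite div1r sqrtrV ?(ltW q2)// in H.
rewrite -H; apply: ae_eq_integral => //.
- apply/measurable_EFinP; apply: measurableT_comp => //; apply: measurableT_comp => //.
  by apply: measurable_funM => //; exact: (measurable_riemann_sum _ bm T0).
- apply/measurable_EFinP; apply: measurableT_comp => //; apply: measurable_funB.
    apply: measurableT_comp => //; apply: measurable_funM => //.
    exact: measurable_walk_sq_sum.
  by apply: measurable_funM => //; apply: measurable_funX; exact: measurable_walk.
- apply: filterS (bm_start bm) => w W0 _; congr (expR _)%:E.
  rewrite !mul0r subr0 /walk_sq_sum /riemann_sum -/h.
  under [in RHS]eq_bigr => i _ do rewrite (wE w W0).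
  by ring.
Qed.

Lemma cvg_cameron_martin (R : realType) (x T l : R) : 0 < T -> 0 < l ->
  let q n := iter n.+1 (riccati_step (T / n.+1%:R) (l ^+ 2 * (T / n.+1%:R))) (0, 1) in
  (Num.sqrt (q n).2)^-1 * expR (- ((q n).1 / (q n).2 / 2 * x ^+ 2)) @[n --> \oo] -->
  cameron_martin x T l.
Proof.
move=> T0 l0 q; have [v u] := cvg_riccati T0 l0.
rewrite -/q in u v.
have c0 : 0 < coshR (l * T) by rewrite divr_gt0// addr_gt0// expR_gt0.
apply: cvgM.
  apply: cvgV; first by rewrite gt_eqF// sqrtr_gt0.
  by apply: continuous_cvg => //; exact: sqrt_continuous.
apply: continuous_cvg; first exact: continuous_expR.
have -> : x ^+ 2 * l / 2 * tanhR (l * T) =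
    l * ((expR (l * T) - expR (- (l * T))) / 2) / coshR (l * T) / 2 * x ^+ 2.
  rewrite /coshR /tanhR; field.
  by rewrite gt_eqF// addr_gt0// expR_gt0.
apply: cvgN; apply: cvgM; last exact: cvg_cst.
apply: cvgM; last exact: cvg_cst.
apply: cvgM => //; apply: cvgV => //.
by rewrite gt_eqF.
Qed.

(** The measure is the law of the quadratic functional.  Its transform is the
    limit of those of the Riemann sums, by dominated convergence with bound [1]. *)
Lemma laplace_sq_integral (R : realType) (d : measure_display)
    (Omega : measurableType d) (P : probability Omega R)
    (W : R -> Omega -> R) (x T : R) :
  brownian_motion P W x -> 0 < T ->
  exists2 m : {measure set R -> \bar R},
    laplace_rep m (cameron_martin x T) &
    forall y : R, m `]-oo, y]%classic = P [set w | sq_integral W T w <= y].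
Proof.
move=> bm T0.
have mI := measurable_sq_integral bm T0.
have I0 w : 0 <= sq_integral W T w.
  by apply: Rintegral_ge0 => s _; exact: sqr_ge0.
have [m mE mint] := exists_pushforward P mI.
exists m; last first.
  by move=> y; rewrite mE//; congr (P _); apply/seteqP; split => w /=; rewrite in_itv.
split.
  rewrite mE// (_ : _ @^-1` _ = set0); first exact: measure0.
  by apply/seteqP; split => // w/=; rewrite in_itv/= ltNge I0.
move=> l l0; rewrite mint; last 2 first.
- exact: measurable_laplace_kernel.
- by move=> t; exact: laplace_kernel_ge0.
have [] := @dominated_convergence _ _ R P setT measurableT
  (fun n w => (expR (- (l ^+ 2 / 2 * riemann_sum W T n w)))%:E)
  (fun w => (laplace_kernel l (sq_integral W T w))%:E) (cst 1%E).
- move=> n; apply/measurable_EFinP; apply: measurableT_comp => //; apply: measurableT_comp => //.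
  by apply: measurable_funM => //; exact: (measurable_riemann_sum _ bm T0).
- exact: (measurableT_comp (measurable_laplace_kernel l) mI).
- apply: aeW => w _; apply: cvg_EFin; first exact: nearW.
  have Rw : - (l ^+ 2 / 2 * riemann_sum W T n w) @[n --> \oo] -->
      - (l ^+ 2 / 2 * sq_integral W T w).
    apply: cvgN; apply: cvgM; first exact: cvg_cst.
    exact: (riemann_sum_sq_integral (w := w) bm T0).
  exact: (@cvg_comp _ _ _ _ expR _ _ _ Rw (@continuous_expR R _)).
- exact: finite_measure_integrable_cst.
- apply: aeW => w n _; rewrite abse_EFin lee_fin ger0_norm ?expR_ge0//.
  rewrite -[leRHS]expR0 ler_expR oppr_le0 mulr_ge0 ?divr_ge0 ?sqr_ge0//.
  rewrite mulr_ge0 ?divr_ge0 ?(ltW T0)//; apply: sumr_ge0 => i _; exact: sqr_ge0.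
move=> _ _ H; apply: (cvg_unique (@ereal_hausdorff R) H) => /=.
have E n := expectation_riemann_sum l n bm T0.
apply: cvg_EFin; first by apply: nearW => n; rewrite /= E.
have C := @cvg_cameron_martin R x T l T0 l0.
apply: cvg_trans C.
apply: near_eq_cvg; apply: nearW => n.
by rewrite /comp E.
Qed.

(** * Logarithms and exponentials of Laplace transforms *)

(** The remainder [f N] vanishes at [0] and has derivative [t^N / (1 - t)], so
    the mean value theorem bounds it by [r^N / (1 - r)]. *)
Lemma cvg_lnN_series (R : realType) (r : R) : 0 < r < 1 ->
  series (fun n => n%:R^-1 * r ^+ n) @ \oo --> - ln (1 - r).
Proof.
move=> /andP[r0 r1].
pose f N (t : R) := - ln (1 - t) - \sum_(n < N) n.+1%:R^-1 * t ^+ n.+1.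
have df N t : 0 <= t <= r -> is_derive t 1 (f N) (t ^+ N / (1 - t)).
  move=> /andP[t0 tr]; have t1 : 0 < 1 - t by lra.
  have dB : is_derive t 1 (fun t : R => 1 - t) (- 1).
    by apply: is_derive_eq; rewrite add0r mul1r.
  have dl := is_deriveN (@is_derive1_comp R (@ln R) (fun t => 1 - t) t _ _ (is_derive1_ln t1) dB).
  elim: N => [|N IH].
    have -> : f 0%N = - (@ln R \o (fun t => 1 - t)).
      by apply/funext => s; rewrite /f big_ord0 subr0.
    by apply: (is_derive_eq dl); rewrite expr0; field; rewrite gt_eqF.
  have dX : is_derive t 1 (fun t : R => t ^+ N.+1) (N.+1%:R * t ^+ N).
    have -> : (fun t : R => t ^+ N.+1) = (id : R -> R) ^+ N.+1 by rewrite fctE.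
    apply: (is_derive_eq (is_deriveX N.+1 (@is_derive_id R R t 1))).
    by rewrite /GRing.scale/= mulr1.
  have fS : f N.+1 = (f N - (fun t : R => N.+1%:R^-1 *: t ^+ N.+1)).
    by apply/funext => s; rewrite /f big_ord_recr/= opprD addrA.
  rewrite fS.
  apply: (is_derive_eq (is_deriveB IH (is_deriveZ N.+1%:R^-1 dX))).
  rewrite /GRing.scale/= mulKf ?pnatr_eq0// exprS; field.
  by rewrite gt_eqF.
have f0 N : f N 0 = 0.
  rewrite /f subr0 ln1 oppr0 big1 ?subr0// => i _.
  by rewrite expr0n/= mulr0.
have fbnd N : 0 <= f N r <= r ^+ N * (1 - r)^-1.
  have [t||c] := @MVT R (f N) (fun t => t ^+ N / (1 - t)) 0 r r0.
  - rewrite in_itv/= => /andP[t0 tr]; apply: df; lra.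
  - apply: derivable_within_continuous => t; rewrite in_itv/= => tr.
    by have [] := df N t tr.
  - rewrite in_itv/= f0 !subr0 => /andP[c0 cr] ->.
    have c1 : 0 < 1 - c by lra.
    have cN : 0 <= c ^+ N by rewrite exprn_ge0// ltW.
    rewrite mulr_ge0 ?divr_ge0 ?(ltW c1) ?(ltW r0)//=.
    apply: (@le_trans _ _ (c ^+ N / (1 - c))).
      by rewrite ler_piMr ?divr_ge0 ?(ltW c1)// ltW.
    apply: ler_pM => //; first by rewrite invr_ge0 ltW.
      by rewrite lerXn2r ?nnegrE ?(ltW c0) ?(ltW r0)// ltW.
    rewrite lef_pV2 ?posrE//; lra.
have cf : f N r @[N --> \oo] --> (0 : R).
  apply: (@squeeze_cvgr _ _ _ _ (cst 0) (fun N => r ^+ N * (1 - r)^-1)).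
  - by apply: nearW => N; exact: fbnd.
  - exact: cvg_cst.
  - rewrite -[X in _ --> X](mul0r (1 - r)^-1); apply: cvgM; last exact: cvg_cst.
    by apply: cvg_expr; rewrite gtr0_norm.
rewrite -(cvg_shiftS (series _)).
have : - ln (1 - r) - f N r @[N --> \oo] --> - ln (1 - r) - 0.
  by apply: cvgB => //; exact: cvg_cst.
rewrite subr0; apply: cvg_trans; apply: near_eq_cvg; apply: nearW => N.
rewrite /f opprB addrC subrK seriesEnat/= big_nat_recl// invr0 mul0r add0r.
by rewrite big_mkord.
Qed.

Lemma laplace_transformed_lnN (R : realType) (f : R -> R) :
  laplace_transformed f -> (forall l, 0 < l -> 0 < f l < 1) ->
  laplace_transformed (fun l => - ln (1 - f l)).
Proof.
move=> mf f01; apply: (@laplace_transformed_pseries R (fun n => n%:R^-1) f) => //.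
by move=> l l0; apply: cvg_lnN_series; exact: f01.
Qed.

Lemma laplace_transformed_expR_sub1 (R : realType) (f : R -> R) :
  laplace_transformed f -> laplace_transformed (fun l => expR (f l) - 1).
Proof.
move=> mf.
(* the exponential series without its constant term *)
apply: (@laplace_transformed_pseries R (fun n => (n != 0%N)%:R / n`!%:R) f) => //.
- move=> l l0; rewrite -(cvg_shiftS (series _)).
  have := @is_cvg_series_exp_coeff R (f l).
  rewrite -(cvg_shiftS (series _)) => H.
  have : series (exp_coeff (f l)) n.+1 - 1 @[n --> \oo] --> expR (f l) - 1.
    by apply: cvgB; [exact: H|exact: cvg_cst].
  apply: cvg_trans; apply: near_eq_cvg; apply: nearW => n.
  rewrite !seriesEnat/= !big_nat_recl// /exp_coeff/= expr0 fact0 !mul0r divr1.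
  rewrite add0r addrC addKr; by apply: eq_bigr => i _; rewrite mul1r mulrC.
Qed.

(** * Comparison with the hitting time *)

(** The small parameter in which [cosh (l T)] and [tanh (l T)] are expanded. *)
Definition nome (R : realType) (T l : R) : R := expR (- (l * (2 * T))).

(** The exponent of the factor by which the main term has to be increased in
    [cameron_martin_factor].  The summand [T^-1] is there to make this a Laplace
    transform of a positive measure ([laplace_transformed_expR_affine]); the
    corresponding term of [loss] compensates it. *)
Definition gain (R : realType) (x T l : R) : R :=
  2^-1 * (- ln (1 - nome T l ^+ 2)) +
  x ^+ 2 * ((l + T^-1) * (nome T l / (1 + nome T l))).

Definition loss (R : realType) (x T l : R) : R :=
  2^-1 * (- ln (1 - nome T l)) + x ^+ 2 / T * (nome T l / (1 + nome T l)).

Lemma nome_bounds (R : realType) (T l : R) : 0 < T -> 0 < l ->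
  0 < nome T l < 1.
Proof.
move=> T0 l0; rewrite expR_gt0 -[ltRHS]expR0 ltr_expR oppr_lt0.
by rewrite mulr_gt0// mulr_gt0.
Qed.

Lemma coshR_nome (R : realType) (T l : R) :
  coshR (l * T) = expR (l * T) * (1 + nome T l) / 2.
Proof.
rewrite /coshR /nome; congr (_ / _); rewrite mulrDr mulr1 -expRD.
by congr (_ + expR _); ring.
Qed.

Lemma tanhR_nome (R : realType) (T l : R) :
  tanhR (l * T) = (1 - nome T l) / (1 + nome T l).
Proof.
have E : expR (- (l * T)) = expR (l * T) * nome T l.
  by rewrite /nome -expRD; congr expR; ring.
rewrite /tanhR E; set e := expR (l * T); set q := nome T l.
have e0 : 0 < e by exact: expR_gt0.
have q0 : 0 < q by exact: expR_gt0.
field; rewrite gt_eqF/=; last by lra.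
by rewrite (_ : e + e * q = e * (1 + q)); [rewrite mulf_neq0 ?gt_eqF//; lra|ring].
Qed.

Lemma expR_half_lnN (R : realType) (z : R) : 0 < z ->
  expR (2^-1 * (- ln z)) = (Num.sqrt z)^-1.
Proof.
move=> z0; rewrite mulrN expRN; congr _^-1.
rewrite -[LHS]ger0_norm ?expR_ge0// -sqrtr_sqr -expRM_natl; congr Num.sqrt.
by rewrite mulrA mulfV ?mul1r ?lnK// pnatr_eq0.
Qed.

(** The alternating series of [q / (1 + q)] hides that this is a Laplace
    transform; it is a product of transforms, the square being that of the sum of
    two independent copies of the functional started at [0]. *)
Lemma nome_over_cameron_martin (R : realType) (T l : R) :
  expR (- (l * T)) * cameron_martin 0 T l ^+ 2 / 2 = nome T l / (1 + nome T l).
Proof.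
have q0 : 0 < nome T l by exact: expR_gt0.
have c0 : 0 <= coshR (l * T).
  by rewrite divr_ge0// addr_ge0// expR_ge0.
rewrite /cameron_martin expr0n/= !mul0r oppr0 expR0 mulr1 exprVn sqr_sqrtr//.
have qE : nome T l = expR (- (l * T)) / expR (l * T).
  by rewrite /nome -expRN -expRD; congr expR; ring.
rewrite coshR_nome {2}qE; field.
by rewrite !gt_eqF ?expR_gt0// ltr_pwDl// ltW.
Qed.

(** Expanding [cosh] and [tanh] in [q]:
    [cosh (l T) = exp (l T) (1 + q) / 2], [tanh (l T) = 1 - 2 q / (1 + q)], and
    [1 + q = (1 - q^2) / (1 - q)], which writes the factor [(1 + q)^(-1/2)] with
    logarithm series that have nonnegative coefficients only. *)
Lemma cameron_martin_factor (R : realType) (x T l : R) : 0 < T -> 0 < l ->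
  cameron_martin x T l * expR (loss x T l) =
  Num.sqrt 2 * expR (- (l * ((T + x ^+ 2) / 2))) * expR (gain x T l).
Proof.
move=> T0 l0; have /andP[q0 q1] := nome_bounds T0 l0.
rewrite /cameron_martin /loss /gain coshR_nome tanhR_nome.
set q := nome T l in q0 q1 *.
have q2 : 0 < 1 - q ^+ 2 by nra.
have q3 : 0 < 1 - q by lra.
have q4 : 0 < 1 + q by lra.
rewrite 2![expR (2^-1 * _ + _)]expRD !expR_half_lnN//.
have -> : 1 - q ^+ 2 = (1 - q) * (1 + q) by ring.
rewrite (sqrtrM (1 + q)) ?(ltW q3)//.
have -> : Num.sqrt (expR (l * T) * (1 + q) / 2) =
    expR (l * T / 2) * Num.sqrt (1 + q) / Num.sqrt 2.
  rewrite sqrtrM ?mulr_ge0 ?expR_ge0 ?(ltW q4)// sqrtrM ?expR_ge0//.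
  rewrite sqrtrV//; congr (_ * _ / _).
  rewrite -[RHS]ger0_norm ?expR_ge0// -sqrtr_sqr -expRM_natl; congr (Num.sqrt (expR _)).
  by field.
have s2 : Num.sqrt 2 != 0 :> R by rewrite gt_eqF// sqrtr_gt0.
have s3 : Num.sqrt (1 - q) != 0 by rewrite gt_eqF// sqrtr_gt0.
have s4 : Num.sqrt (1 + q) != 0 by rewrite gt_eqF// sqrtr_gt0.
rewrite !invfM invrK -expRN.
set A := expR (- (l * T / 2)); set B := expR (- (x ^+ 2 * l / 2 * _)).
set C := expR (x ^+ 2 / T * _); set D := expR (- (l * _)).
set E := expR (x ^+ 2 * _).
have ABC : A * B * C = D * E.
  rewrite /A /B /C /D /E -!expRD; congr expR.
  by field; rewrite !gt_eqF.
transitivity (Num.sqrt 2 * (Num.sqrt (1 + q))^-1 * (Num.sqrt (1 - q))^-1 * (A * B * C)).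
  by ring.
by rewrite ABC; ring.
Qed.

Lemma laplace_transformed_expR (R : realType) (b : R) : 0 < b ->
  laplace_transformed (fun l => expR (- (l * b))).
Proof. by move=> /exists_laplace_rep_expR[m mE _]; exists m. Qed.

Lemma laplace_transformed_loss (R : realType) (x T : R) : 0 < T ->
  laplace_transformed (cameron_martin 0 T) ->
  laplace_transformed (loss x T).
Proof.
move=> T0 L0.
have e1 : laplace_transformed (fun l => expR (- (l * T))) by exact: laplace_transformed_expR.
have e2 : laplace_transformed (nome T).
  by apply: laplace_transformed_expR; rewrite mulr_gt0.
apply: laplace_transformedD.
  apply: laplace_transformedZ => //; apply: laplace_transformed_lnN => // l l0.
  exact: nome_bounds.
apply: laplace_transformedZ; first by rewrite divr_ge0 ?sqr_ge0// ltW.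
apply: (@eq_laplace_transformed _
  (fun l => 2^-1 * (expR (- (l * T)) * cameron_martin 0 T l ^+ 2))).
  by move=> l l0; rewrite -nome_over_cameron_martin mulrC.
apply: laplace_transformedZ => //.
by apply: laplace_transformedM => //; exact: laplace_transformedX.
Qed.

Lemma laplace_transformed_gain (R : realType) (x T : R) : 0 < T ->
  laplace_transformed (cameron_martin 0 T) ->
  laplace_transformed (gain x T).
Proof.
move=> T0 L0.
have e2 : laplace_transformed (nome T).
  by apply: laplace_transformed_expR; rewrite mulr_gt0.
apply: laplace_transformedD.
  apply: laplace_transformedZ => //; apply: laplace_transformed_lnN.
    exact: laplace_transformedX.
  move=> l l0; have /andP[q0 q1] := nome_bounds T0 l0.
  by rewrite exprn_gt0//= exprn_ilt1// ltW.
apply: laplace_transformedZ; first exact: sqr_ge0.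
apply: (@eq_laplace_transformed _
  (fun l => 2^-1 * ((l + T^-1) * expR (- (l * T)) * cameron_martin 0 T l ^+ 2))).
  by move=> l l0; rewrite -nome_over_cameron_martin; ring.
apply: laplace_transformedZ => //; apply: laplace_transformedM.
  exact: laplace_transformed_expR_affine.
exact: laplace_transformedX.
Qed.

(** Moving the negative correction [exp (- loss)] to the other side of
    [cameron_martin_factor] leaves sums of Laplace transforms of positive
    measures.  Here [G] is the probability that the hitting time of [a] is at
    most [y], and [l = a / y] minimizes [l^2 y / 2 - l a]. *)
Lemma cdf_hitting_comparison (R : realType) (d : measure_display)
    (Omega : measurableType d) (P P0 : probability Omega R)
    (W : R -> Omega -> R) (x T y : R) :
  brownian_motion P W x -> brownian_motion P0 W 0 -> 0 < T -> 0 < y ->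
  let a := (T + x ^+ 2) / 2 in
  exists2 G : R,
    (\int[lebesgue_measure]_(z in `[(a / Num.sqrt y)%R, +oo[)
        (2 * std_normal_pdf z)%:E = G%:E)%E &
    `|fine (P [set w | sq_integral W T w <= y]) - Num.sqrt 2 * G| <=
      Num.sqrt 2 * expR (- (a ^+ 2 / (2 * y))) *
      (expR (gain x T (a / y)) * (loss x T (a / y) + gain x T (a / y))).
Proof.
move=> bm bm0 T0 y0 a.
have a0 : 0 < a by rewrite divr_gt0// ltr_pwDl// sqr_ge0.
pose l0 := a / y; have l00 : 0 < l0 by rewrite divr_gt0.
have [mL mLf mLy] := laplace_sq_integral bm T0.
have [m0 m0f _] := laplace_sq_integral bm0 T0.
have L0 : laplace_transformed (cameron_martin 0 T) by exists m0.
have Lx : laplace_transformed (cameron_martin x T) by exists mL.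
have [mG mGf mGy] := exists_laplace_rep_expR a0.
have [mN mNf] : laplace_transformed
    (fun l => cameron_martin x T l * (expR (loss x T l) - 1)).
  apply: laplace_transformedM => //; apply: laplace_transformed_expR_sub1.
  exact: laplace_transformed_loss.
have [mP mPf] : laplace_transformed
    (fun l => Num.sqrt 2 * (expR (- (l * a)) * (expR (gain x T l) - 1))).
  apply: laplace_transformedZ; first exact: sqrtr_ge0.
  apply: laplace_transformedM; first by exists mG.
  by apply: laplace_transformed_expR_sub1; exact: laplace_transformed_gain.
have s20 : 0 <= Num.sqrt 2 :> R by exact: sqrtr_ge0.
have mGf2 : laplace_rep (mscale (NngNum s20) mG) (fun l => Num.sqrt 2 * expR (- (l * a))).
  exact: laplace_repZ.
have E := laplace_rep_unique_add y mLf mNf mGf2 mPf.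
have {}E : (mL `]-oo, y]%classic + mN `]-oo, y]%classic =
    (Num.sqrt 2)%:E * mG `]-oo, y]%classic + mP `]-oo, y]%classic)%E.
  apply: E => l l1; rewrite mulrBr mulr1 addrC subrK cameron_martin_factor//.
  by rewrite -mulrA; ring.
have cN := laplace_rep_chernoff y mNf l00.
have cP := laplace_rep_chernoff y mPf l00.
have cG := laplace_rep_chernoff y mGf l00.
have cL := laplace_rep_chernoff y mLf l00.
have fin (m : {measure set R -> \bar R}) (c : R) :
    (m `]-oo, y]%classic <= c%:E)%E -> exists2 r : R, m `]-oo, y]%classic = r%:E & 0 <= r <= c.
  move=> mc; exists (fine (m `]-oo, y]%classic)).
    by rewrite fineK// ge0_fin_numE// (le_lt_trans mc)// ltry.
  by rewrite fine_ge0//= -lee_fin fineK// ge0_fin_numE// (le_lt_trans mc)// ltry.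
have [n nE /andP[n0 nle]] := fin _ _ cN.
have [p pE /andP[p0 ple]] := fin _ _ cP.
have [G GE _] := fin _ _ cG.
have [F FE _] := fin _ _ cL.
exists G; first by rewrite -mGy.
rewrite -mLy FE/=.
move: E; rewrite nE pE GE FE -EFinM -!EFinD => -[] E.
have -> : F - Num.sqrt 2 * G = p - n by lra.
apply: (@le_trans _ _ (p + n)).
  by rewrite (le_trans (ler_normB _ _))// !ger0_norm.
set g := gain x T l0 in ple *; set w := loss x T l0 in nle *.
have g0 : 0 <= g.
  by have [mg mgf] := laplace_transformed_gain x T0 L0; exact: laplace_rep_ge0 mgf l00.
have w0 : 0 <= w.
  by have [mw mwf] := laplace_transformed_loss x T0 L0; exact: laplace_rep_ge0 mwf l00.
have K : expR (l0 ^+ 2 / 2 * y) * (Num.sqrt 2 * expR (- (l0 * a))) =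
    Num.sqrt 2 * expR (- (a ^+ 2 / (2 * y))).
  rewrite mulrCA -expRD; congr (_ * expR _).
  by rewrite /l0; field; rewrite gt_eqF.
(* by the factorization, both corrections at the saddle
   point are multiples of the main term *)
have cmE : cameron_martin x T l0 =
    Num.sqrt 2 * expR (- (l0 * a)) * expR g * expR (- w).
  by rewrite -cameron_martin_factor// -mulrA -expRD subrr expR0 mulr1.
have ple' : p <= Num.sqrt 2 * expR (- (a ^+ 2 / (2 * y))) * (expR g * g).
  apply: (le_trans ple); rewrite [X in _ * X]mulrA mulrA K.
  apply: ler_wpM2l; first by rewrite mulr_ge0// expR_ge0.
  have H := expR_ge1Dx (- g); have H' := expR_gt0 g.
  have : expR g * (1 + - g) <= expR g * expR (- g) by rewrite ler_wpM2l// ltW.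
  rewrite -expRD subrr expR0; lra.
have nle' : n <= Num.sqrt 2 * expR (- (a ^+ 2 / (2 * y))) * (expR g * w).
  apply: (le_trans nle); rewrite cmE.
  set A := expR (l0 ^+ 2 / 2 * y) in K *; set B := Num.sqrt 2 * expR (- (l0 * a)) in K *.
  have -> : A * (B * expR g * expR (- w) * (expR w - 1)) =
      A * B * (expR g * (expR (- w) * (expR w - 1))) by ring.
  rewrite K; apply: ler_wpM2l; first by rewrite mulr_ge0// expR_ge0.
  apply: ler_wpM2l; first exact: expR_ge0.
  rewrite mulrBr -expRD addNr expR0 mulr1; have := expR_ge1Dx (- w); lra.
by rewrite (addrC w) mulrDr [leRHS]mulrDr; exact: lerD.
Qed.

(** * Asymptotics *)

Lemma expRN_le_pow4 (R : realType) (r : R) : 0 < r -> expR (- r) <= 256 / r ^+ 4.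
Proof.
move=> r0; rewrite expRN -[leRHS]invrK.
rewrite lef_pV2 ?posrE ?expR_gt0 ?invr_gt0 ?divr_gt0 ?exprn_gt0 ?ltr0n//.
have -> : (256 / r ^+ 4)^-1 = (r / 4) ^+ 4 by field; rewrite gt_eqF.
have -> : expR r = expR (r / 4) ^+ 4 by rewrite -expRM_natl; congr expR; field.
rewrite lerXn2r ?nnegrE ?expR_ge0 ?divr_ge0 ?(ltW r0)//.
by apply: le_trans (expR_ge1Dx _); rewrite lerDr.
Qed.

Lemma lnN_le (R : realType) (s : R) : 0 <= s -> s <= 2^-1 -> - ln (1 - s) <= 2 * s.
Proof.
move=> s0 s1; have s2 : 0 < 1 - s by lra.
rewrite -lnV ?posrE//; have : (1 - s)^-1 <= expR (2 * s).
  apply: le_trans (expR_ge1Dx _).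
  by rewrite -[leLHS]mul1r ler_pdivrMr//; nra.
by move=> H; rewrite -[leRHS]expRK ler_ln ?posrE ?expR_gt0 ?invr_gt0.
Qed.

(** At [l = a / y] one has [q <= exp (- r)] with [r = T^2 / y], and
    [loss + gain <= (r + 4) q]; the fourth power bound on the exponential then
    leaves a factor [r^-3]. *)
Lemma gain_loss_bound (R : realType) (x T y : R) :
  1 <= T -> 0 < y -> x ^+ 2 <= T -> 1280 <= T ^+ 2 * y^-1 ->
  let r := T ^+ 2 * y^-1 in
  let l := (T + x ^+ 2) / 2 / y in
  [/\ 0 <= gain x T l, 0 <= loss x T l & loss x T l + gain x T l <= 1280 / r ^+ 3].
Proof.
move=> T1 y0 xT r_ge r l.
rewrite -/r in r_ge.
have T0 : 0 < T by lra.
have x2 := sqr_ge0 x.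
have l0 : 0 < l by rewrite !divr_gt0//; lra.
have r0 : 0 < r by apply: lt_le_trans r_ge; rewrite ltr0n.
have /andP[q0 q1] := nome_bounds T0 l0.
have lTE : l * (2 * T) = r + r * (x ^+ 2 / T).
  by rewrite /l /r; field; rewrite !gt_eqF.
have xT1 : 0 <= x ^+ 2 / T <= 1.
  by rewrite divr_ge0 ?(ltW T0)//= ler_pdivrMr// mul1r.
have qr : nome T l <= 256 / r ^+ 4.
  apply: le_trans (expRN_le_pow4 r0); rewrite ler_expR lerN2 lTE lerDl mulr_ge0 ?(ltW r0)//.
  by case/andP: xT1.
have r3 : 0 < r ^+ 3 by rewrite exprn_gt0.
(* the lower bound 1280 on r makes q at most 1/2, where - ln (1 - q) <= 2 q *)
have q12 : nome T l <= 2^-1.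
  apply: (le_trans qr); rewrite ler_pdivrMr ?exprn_gt0// exprSr.
  have : 1 <= r ^+ 3 by rewrite exprn_ege1//; lra.
  nra.
set q := nome T l in q0 q1 qr q12.
have L1 := lnN_le (ltW q0) q12.
have q2q : q ^+ 2 <= q by nra.
have L2 : - ln (1 - q ^+ 2) <= 2 * q ^+ 2.
  by apply: lnN_le; [exact: sqr_ge0|lra].
have L3 : 0 <= - ln (1 - q) by rewrite oppr_ge0 ln_le0//; lra.
have L4 : 0 <= - ln (1 - q ^+ 2).
  by rewrite oppr_ge0 ln_le0//; have := sqr_ge0 q; lra.
pose t := q / (1 + q).
have t0 : 0 <= t by rewrite divr_ge0//; lra.
have tq : t <= q by rewrite ler_pdivrMr ?ltr_pwDl//; [nra|lra].
have Ti0 : 0 < T^-1 by rewrite invr_gt0.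
have e1 : 0 <= x ^+ 2 * ((l + T^-1) * t).
  by rewrite mulr_ge0// mulr_ge0// addr_ge0// ltW.
have e2 : 0 <= x ^+ 2 / T * t by rewrite mulr_ge0// divr_ge0// ltW.
split.
- by rewrite /gain -/q -/t; lra.
- by rewrite /loss -/q -/t; lra.
have xl : x ^+ 2 * l <= r.
  apply: (@le_trans _ _ (T * l)); first by rewrite ler_wpM2r// ltW.
  have : T * l * 2 = r + r * (x ^+ 2 / T) by rewrite -lTE; ring.
  have : r * (x ^+ 2 / T) <= r by rewrite ler_piMr ?(ltW r0)//; case/andP: xT1.
  lra.
have key : x ^+ 2 * ((l + T^-1) * t) + x ^+ 2 / T * t <= (r + 2) * q.
  have -> : x ^+ 2 * ((l + T^-1) * t) + x ^+ 2 / T * t =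
     (x ^+ 2 * l + 2 * (x ^+ 2 / T)) * t by ring.
  apply: ler_pM => //; last first.
    by case/andP: xT1 => _; lra.
  apply: addr_ge0; first by rewrite mulr_ge0// ltW.
  by case/andP: xT1 => + _; lra.
apply: (@le_trans _ _ ((r + 4) * q)).
  by rewrite /gain /loss -/q -/t; lra.
(* r + 4 <= 5 r, and 5 * 256 = 1280 *)
apply: (@le_trans _ _ (5 * r * (256 / r ^+ 4))).
  by apply: ler_pM => //; lra.
rewrite le_eqVlt; apply/orP; left; apply/eqP; field; rewrite gt_eqF//.
Qed.

Definition cdf_equivalent (R : realType) (x T y : R) : R :=
  4 / Num.sqrt (pi * T ^+ 2 * y^-1) *
  expR (- ((T + x ^+ 2) ^+ 2 / (8 * y))).

(** The Mills bounds compare the main term [sqrt 2 * G] with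
    [T / (T + x^2)] times the equivalent, and the comparison error, of order
    [r^-3], is small against the prefactor [r^(-1/2)]. *)
Lemma cdf_ratio_bounds (R : realType) (d : measure_display)
    (Omega : measurableType d) (P P0 : probability Omega R)
    (W : R -> Omega -> R) (x T y : R) :
  brownian_motion P W x -> brownian_motion P0 W 0 ->
  1 <= T -> 0 < y -> x ^+ 2 <= T -> 1280 <= T ^+ 2 * y^-1 ->
  T / (T + x ^+ 2) / (1 + 4 / (T ^+ 2 * y^-1)) -
      1280 * expR 1 / (T ^+ 2 * y^-1) <=
    fine (P [set w | sq_integral W T w <= y]) / cdf_equivalent x T y <=
  T / (T + x ^+ 2) + 1280 * expR 1 / (T ^+ 2 * y^-1).
Proof.
move=> bm bm0 T1 y0 xT r_ge.
set r := T ^+ 2 * y^-1 in r_ge *; set rho := T / (T + x ^+ 2).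
set D := cdf_equivalent x T y.
have T0 : 0 < T by lra.
have x2 := sqr_ge0 x.
have r0 : 0 < r by apply: lt_le_trans r_ge; rewrite ltr0n.
have [G GE FG] := cdf_hitting_comparison bm bm0 T0 y0.
have [g0 w0 gw] := gain_loss_bound T1 y0 xT r_ge.
rewrite -/r in gw.
pose a := (T + x ^+ 2) / 2.
rewrite -/a in GE FG g0 w0 gw *.
have a0 : 0 < a by rewrite divr_gt0//; lra.
set F := fine _ in FG *.
set g := gain _ _ _ in g0 gw FG *; set w := loss _ _ _ in w0 gw FG *.
pose s := Num.sqrt y; have s0 : 0 < s by rewrite sqrtr_gt0.
have yE : y = s ^+ 2 by rewrite sqr_sqrtr// ltW.
pose p := Num.sqrt pi : R; have p0 : 0 < p by rewrite sqrtr_gt0 pi_gt0.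
pose k := Num.sqrt 2 : R; have k0 : 0 < k by rewrite sqrtr_gt0.
have k2 : k ^+ 2 = 2 by rewrite sqr_sqrtr.
pose E := expR (- (a ^+ 2 / (2 * y))).
have E0 : 0 < E by exact: expR_gt0.
have DE : D = 4 * s / (p * T) * E.
  have pE : pi = p ^+ 2 by rewrite sqr_sqrtr// pi_ge0.
  have -> : D = 4 / Num.sqrt ((p * T / s) ^+ 2) * E.
    rewrite /D /cdf_equivalent /E pE; congr (4 / Num.sqrt _ * expR (- _)).
      by rewrite yE; field; rewrite gt_eqF.
    by rewrite /a; field; rewrite gt_eqF.
  have psT : 0 < p * T / s by rewrite divr_gt0// mulr_gt0.
  rewrite sqrtr_sqr (gtr0_norm psT); congr (_ * E).
  by field; rewrite !gt_eqF.
have D0 : 0 < D by rewrite DE mulr_gt0// divr_gt0 ?mulr_gt0.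
pose u := a / s; have u0 : 0 < u by rewrite divr_gt0.
have phiE : std_normal_pdf u = (k * p)^-1 * E.
  rewrite /std_normal_pdf sqrtrM//; congr (_ * expR (- _)).
  by rewrite /u yE; field; rewrite gt_eqF.
have GuB := gaussian_tail_le u0; have GlB := gaussian_tail_ge u0.
rewrite /u -/s GE !lee_fin -/u phiE in GuB GlB.
have mainE : k * (2 * ((k * p)^-1 * E) / u) = rho * D.
  rewrite DE /rho /u /a; field.
  by rewrite !gt_eqF//=; lra.
have up : k * G <= rho * D by rewrite -mainE ler_wpM2l ?(ltW k0).
have u2 : u ^- 2 <= 4 / r.
  have -> : u ^- 2 = (2 * s / (T + x ^+ 2)) ^+ 2.
    by rewrite /u /a; field; rewrite !gt_eqF//; lra.
  have -> : 4 / r = (2 * s / T) ^+ 2.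
    by rewrite /r yE; field; rewrite !gt_eqF.
  rewrite ler_sqr ?nnegrE ?divr_ge0 ?mulr_ge0 ?(ltW s0) ?(ltW T0)//; last by lra.
  by rewrite ler_wpM2l ?mulr_ge0 ?(ltW s0)// lef_pV2 ?posrE//; lra.
have Tx0 : 0 <= T + x ^+ 2 by rewrite addr_ge0 ?(ltW T0).
have rho0 : 0 <= rho by apply: divr_ge0 => //; exact: ltW.
have ui0 : 0 <= u ^- 2 by rewrite invr_ge0 sqr_ge0.
have r40 : 0 <= 4 / r by rewrite divr_ge0// ltW.
have lo : rho / (1 + 4 / r) * D <= k * G.
  apply: (@le_trans _ _ (k * (2 * ((k * p)^-1 * E) / u / (1 + u ^- 2)))); last first.
    by rewrite ler_wpM2l ?(ltW k0).
  rewrite [leRHS]mulrA mainE [leLHS]mulrAC; apply: ler_wpM2l; first by rewrite mulr_ge0 ?(ltW D0).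
  by rewrite lef_pV2 ?posrE ?lerD2l ?ltr_wpDr.
have err : `|F - k * G| <= 1280 * expR 1 / r * D.
  apply: (le_trans FG); rewrite -/k -/E DE.
  have -> : 1280 * expR 1 / r * (4 * s / (p * T) * E) =
     k * E * (4 * s / (p * k * T * r) * (1280 * expR 1)).
    by field; rewrite !gt_eqF.
  apply: ler_wpM2l; first by rewrite mulr_ge0 ?(ltW k0) ?(ltW E0).
  have r1 : 1 <= r by apply: le_trans r_ge; rewrite ler1n.
  have g1 : g <= 1.
    apply: (@le_trans _ _ (1280 / r ^+ 3)); first by lra.
    rewrite ler_pdivrMr ?exprn_gt0// mul1r (le_trans r_ge)// -/r exprSr.
    by rewrite ler_peMl ?(ltW r0)// exprn_ege1.
  apply: (@le_trans _ _ (expR 1 * (1280 / r ^+ 3))).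
    apply: (ler_pM (expR_ge0 _) _ _ gw); first exact: addr_ge0.
    by rewrite ler_expR.
  have -> : expR 1 * (1280 / r ^+ 3) = r ^- 3 * (1280 * expR 1 : R).
    by field; rewrite gt_eqF.
  apply: ler_wpM2r; first exact: (mulr_ge0 (ler0n _ _) (expR_ge0 _)).
  have pk4 : p * k <= 4.
    have pp : p ^+ 2 <= 4.
      by rewrite sqr_sqrtr ?pi_ge0//; have := @pihalf_lt2 R; lra.
    rewrite -(@ler_pXn2r _ 2) ?nnegrE ?mulr_ge0 ?(ltW p0) ?(ltW k0)//.
    by rewrite exprMn k2; lra.
  (* in terms of t = sqrt r, the prefactor of the equivalent is of order t^-1 *)
  pose t := T / s; have t0 : 0 < t by rewrite divr_gt0.
  have rt : r = t ^+ 2 by rewrite /r /t yE; field; rewrite gt_eqF.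
  have t1 : 1 <= t by rewrite -(@ler_pXn2r _ 2) ?nnegrE ?(ltW t0)// expr1n -rt.
  have -> : 4 * s / (p * k * T * r) = 4 / (p * k) * t ^- 3.
    by rewrite rt /t; field; rewrite !gt_eqF.
  apply: (@le_trans _ _ (t ^- 3)); last first.
    rewrite ler_peMl ?invr_ge0 ?exprn_ge0 ?(ltW t0)//.
    by rewrite ler_pdivlMr ?mulr_gt0// mul1r.
  rewrite lef_pV2 ?posrE ?exprn_gt0// lerXn2r ?nnegrE ?(ltW t0) ?(ltW r0)//.
  by rewrite rt expr2 ler_peMl// ltW.
rewrite ler_norml lerNl opprB !lerBlDr in err.
have /andP[err1 err2] := err.
apply/andP; split.
  rewrite ler_pdivlMr// mulrBl lerBlDr; apply: (le_trans lo).
  by rewrite addrC.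
by rewrite ler_pdivrMr// mulrDl; apply: (le_trans err2); rewrite addrC lerD2r.
Qed.

Lemma drift_ratio_bounds (R : realType) (T z : R) :
  0 < T -> 0 <= z -> z <= Num.sqrt T ->
  1 / (1 + (Num.sqrt T)^-1) <= T / (T + z) <= 1.
Proof.
move=> T0 z0 zT; have s0 : 0 < Num.sqrt T by rewrite sqrtr_gt0.
apply/andP; split; last first.
  by rewrite ler_pdivrMr ?ltr_pwDl// mul1r lerDl.
have TE : T = Num.sqrt T ^+ 2 by rewrite sqr_sqrtr// ltW.
rewrite ler_pdivlMr ?ltr_pwDl// mulrAC ler_pdivrMr ?ltr_pwDl ?invr_gt0//.
rewrite mul1r mulrDr mulr1 lerD2l {1}TE expr2 mulfK ?gt_eqF//.
Qed.

Theorem proposition6 (R : realType) (d : measure_display)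
    (Omega : measurableType d) (P : R -> probability Omega R)
    (W : R -> Omega -> R)
    (hW : forall x : R, brownian_motion (P x) W x)
    (x y : R -> R)
    (hx : forall T : R, 0 < T -> x T ^+ 2 <= T `^ (1 / 4))
    (hy : forall T : R, 0 < T -> 0 < y T)
    (hTy : T ^+ 2 * (y T)^-1 @[T --> +oo] --> +oo) :
  asymp_equiv
    (fun T : R => sq_integral_cdf P W (x T) T (y T))
    (fun T : R =>
       4 / Num.sqrt (pi * T ^+ 2 * (y T)^-1) *
       expR (- ((T + x T ^+ 2) ^+ 2 / (8 * y T)))).
Proof.
pose r T := T ^+ 2 * (y T)^-1.
have r_ge : \forall T \near +oo, 1280 <= r T.
  by move/cvgryPge : hTy; exact.
have rV : (r T)^-1 @[T --> +oo] --> (0 : R).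
  apply/gtr0_cvgV0 => //.
  by apply: filterS r_ge => T; apply: lt_le_trans; rewrite ltr0n.
have sV : (Num.sqrt T)^-1 @[T --> +oo] --> (0 : R).
  apply/gtr0_cvgV0.
    by near=> T; rewrite sqrtr_gt0; near: T; exact: nbhs_pinfty_gt.
  apply/cvgryPge => A; near=> T.
  apply: (@le_trans _ _ `|A|); first exact: ler_norm.
  rewrite -sqrtr_sqr ler_sqrt; last by near: T; apply: nbhs_pinfty_ge; exact: num_real.
  by near: T; apply: nbhs_pinfty_ge; exact: num_real.
pose C : R := 1280 * expR 1.
rewrite /asymp_equiv.
apply: (@squeeze_cvgr _ _ _ _
    (fun T => 1 / (1 + (Num.sqrt T)^-1) / (1 + 4 * (r T)^-1) - C * (r T)^-1)
    (fun T => 1 + C * (r T)^-1)).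
- near=> T.
  have T1 : 1 <= T by near: T; exact: nbhs_pinfty_ge.
  have T0 : 0 < T by apply: lt_le_trans T1.
  have rT : 1280 <= r T by near: T.
  have r0 : 0 < r T by apply: lt_le_trans rT; rewrite ltr0n.
  have xs : x T ^+ 2 <= Num.sqrt T.
    apply: (le_trans (hx T T0)); rewrite -powR12_sqrt ?(ltW T0)//.
    by rewrite ler_powR//; lra.
  have xT : x T ^+ 2 <= T.
    apply: (le_trans xs); rewrite -[leRHS](@sqr_sqrtr _ T) ?(ltW T0)//.
    by rewrite expr2 ler_peMl ?sqrtr_ge0// -[leLHS]sqrtr1 ler_sqrt// ltW.
  have /andP[lo up] := cdf_ratio_bounds (hW (x T)) (hW 0) T1 (hy T T0) xT rT.
  have /andP[rho_ge rho_le] := drift_ratio_bounds T0 (sqr_ge0 (x T)) xs.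
  apply/andP; split.
    apply: le_trans lo; rewrite lerD2r; apply: ler_wpM2r => //.
    by rewrite invr_ge0 addr_ge0// mulr_ge0// invr_ge0 ltW.
  by apply: (le_trans up); rewrite lerD2r.
- rewrite [X in _ --> X](_ : 1 = 1 / (1 + 0) / (1 + 4 * 0) - C * 0 :> R); last by field.
  apply: cvgB; last exact: cvgMl_tmp.
  apply: cvgM; last first.
    apply: cvgV; first by rewrite mulr0 addr0 oner_neq0.
    by apply: cvgD; [exact: cvg_cst|exact: cvgMl_tmp].
  apply: cvgM; first exact: cvg_cst.
  apply: cvgV; first by rewrite addr0 oner_neq0.
  by apply: cvgD; [exact: cvg_cst|].
- rewrite [X in _ --> X](_ : 1 = 1 + C * 0 :> R); last by rewrite mulr0 addr0.
  by apply: cvgD; [exact: cvg_cst|exact: cvgMl_tmp].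
Unshelve. all: by end_near.
Qed.
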